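(* Let $\xi$ be a real smooth vector bundle over a differentiable manifold $M$, and let $\nabla:\Omega^0(\xi)\to\Omega^1(\xi)$ be a pseudoconnection of $\xi$ with principal homomorphism $P$ and exterior derivative $d^\nabla$. Define $$F^\nabla=P\circ d^\nabla\circ\nabla-d^\nabla\circ P\circ\nabla+d^\nabla\circ\nabla\circ P:\Omega^0(\xi)\to\Omega^2(\xi),\qquad L^\nabla=P\circ\nabla-\nabla\circ P:\Omega^0(\xi)\to\Omega^1(\xi).$$ Then $F^\nabla$ and $L^\nabla$ are homomorphisms of $\Omega^0(M)$-modules, i.e. $F^\nabla\in Hom(\Omega^0(\xi),\Omega^2(\xi))$ and $L^\nabla\in Hom(\Omega^0(\xi),\Omega^1(\xi))$.
   Context: $\Omega^0(M)$ is the ring of $C^\infty$ real-valued functions on $M$, $\Omega^k(M)$ the $\Omega^0(M)$-module of smooth $k$-forms, $d$ the standard exterior derivative. For a real smooth vector bundle $\xi$ over $M$, $\Omega^0(\xi)$ is the $\Omega^0(M)$-module of smooth sections of $\xi$, and $\Omega^k(\xi)=\Omega^k(M)\otimes_{\Omega^0(M)}\Omega^0(\xi)$ for $k\ge 1$. $Hom(A,B)$ denotes the $\Omega^0(M)$-module homomorphisms from $A$ to $B$. $HOM(\xi,\xi)$ is the set of bundle homomorphisms $\xi\to\xi$ over the identity of $M$; each $P\in HOM(\xi,\xi)$ acts on sections and on $\Omega^k(\xi)$ by $P(\omega\otimes s)=\omega\otimes P(s)$. The product $\wedge:\Omega^k(M)\times\Omega^l(\xi)\to\Omega^{k+l}(\xi)$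 is given on generators by $\beta\wedge(\omega\otimes s)=(\beta\wedge\omega)\otimes s$. A pseudoconnection of $\xi$ with principal homomorphism $P\in HOM(\xi,\xi)$ is an $\mathbb{R}$-linear map $\nabla:\Omega^0(\xi)\to\Omega^1(\xi)$ such that $\nabla(f\cdot s)=df\otimes P(s)+f\cdot\nabla(s)$ for all $f\in\Omega^0(M)$, $s\in\Omega^0(\xi)$. Its exterior derivative is the sequence of $\mathbb{R}$-linear maps $d^\nabla:\Omega^k(\xi)\to\Omega^{k+1}(\xi)$, $k\ge0$, with $d^\nabla=\nabla$ for $k=0$, determined on generators by $d^\nabla(\omega\otimes s)=d\omega\otimes P(s)+(-1)^k\omega\wedge\nabla s$ for $\omega\in\Omega^k(M)$, $s\in\Omega^0(\xi)$. *)

(* Defs.v *)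
From HB Require Import structures.
From mathcomp Require Import all_boot all_order all_algebra all_fingroup generic_quotient.
From mathcomp Require Import all_classical all_reals topology normedtype landau derive.
Import Order.TTheory GRing.Theory Num.Theory.
Import numFieldTopology.Exports numFieldNormedType.Exports.
Set Implicit Arguments. Unset Strict Implicit. Unset Printing Implicit Defensive.
Local Open Scope classical_set_scope.
Local Open Scope ring_scope.

Section calculus.
Variables (R : realType) (V W : normedModType R).
Implicit Types (D : set V) (f g : V -> W) (k : nat).

(* Intended for open D: f is of class C^(k+1) on D when it is Frechet
   differentiable on D and all its directional derivatives are C^k on D. *)
Fixpoint Ck k D f : Prop :=
  if k is k'.+1 then
    (forall x, D x -> differentiable f x) /\ (forall v, Ck k' D ('D_v f))
  else forall x, D x -> {for x, continuous f}.

Definition smooth_on D f : Prop := forall k, Ck k D f.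

Lemma near_eq_differentiable f g x :
  {near x, f =1 g} -> differentiable f x -> differentiable g x.
Proof.
move=> fg df.
have -> : g = f + (g - f) by rewrite addrC subrK.
apply: differentiableD; first exact: df.
pose h := g - f; rewrite -/h.
have h0 : \forall y \near x, h y = 0.
  apply: filterS fg => y fgy.
  by rewrite /h -[LHS]/(g y - f y) fgy subrr.
have hx : h x = 0 by exact: nbhs_singleton h0.
have ho : h \o shift x = cst (h x) + \0 +o_ (0 : V) id.
  apply/eqaddoP => e e0.
  have : \forall y \near (0:V), h (y + x) = 0.
    by rewrite (near_shift x 0) /=; near=> y; rewrite /= sub0r subrK; near: y.
  apply: filterS => y hy.
  have E : h (y + x) - (h x + 0) = 0 by rewrite hy hx addr0 subrr.
  suff : `|h (y + x) - (h x + 0)| <= e * `|y| by [].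
  by rewrite E normr0 mulr_ge0 // ltW.
have d0 : 'd h x = \0 :> (V -> W).
  by apply: (@diff_unique R V W h \0 x) => //; apply: cst_continuous.
by apply/diff_locallyP; rewrite d0; split => //; apply: cst_continuous.
Unshelve. all: by end_near. Qed.

Lemma Ck_sub k D D' f : D' `<=` D -> Ck k D f -> Ck k D' f.
Proof.
move=> sD; elim: k f => [|k IH] f /=; first by move=> h x /sD; exact: h.
by move=> [h1 h2]; split=> [x /sD/h1//|v]; exact: IH.
Qed.

Lemma CkS k D f : Ck k.+1 D f -> Ck k D f.
Proof.
elim: k f => [|k IH] f [h1 h2]; first by move=> x /h1/differentiable_continuous.
by split=> // v; exact: IH.
Qed.

Lemma near_eq_continuous f g x : {near x, f =1 g} ->
  {for x, continuous f} -> {for x, continuous g}.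
Proof.
move=> fg cf; rewrite /prop_for /continuous_at -(nbhs_singleton fg).
by apply: cvg_trans cf; apply: near_eq_cvg; apply: filterS fg => y ->.
Qed.

Lemma Ck_ext k D f g : open D -> (forall x, D x -> f x = g x) ->
  Ck k D f -> Ck k D g.
Proof.
move=> oD; elim: k f g => [|k IH] f g fg /=.
  move=> cf x Dx; apply: near_eq_continuous (cf x Dx).
  by near=> y; apply: fg; near: y; exact: open_nbhs_nbhs.
move=> [h1 h2]; split.
  move=> x Dx; apply: near_eq_differentiable (h1 x Dx).
  by near=> y; apply: fg; near: y; exact: open_nbhs_nbhs.
move=> v; apply: IH (h2 v) => x Dx; apply: near_eq_derive.
by near=> y; apply: fg; near: y; exact: open_nbhs_nbhs.
Unshelve. all: by end_near. Qed.

Lemma Ck_cst k D (c : W) : Ck k D (cst c).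
Proof.
elim: k c => [|k IH] c /=; first by move=> x _; exact: cst_continuous.
split=> [x _|v]; first exact: differentiable_cst.
suff -> : 'D_v (cst c) = cst (0 : W) :> (V -> W) by exact: IH.
by apply/funext => x; rewrite derive_cst.
Qed.

Lemma CkD k D f g : open D -> Ck k D f -> Ck k D g -> Ck k D (f + g).
Proof.
move=> oD; elim: k f g => [|k IH] f g /=.
  by move=> h1 h2 x Dx; apply: continuousD; [exact: h1|exact: h2].
move=> [f1 f2] [g1 g2]; split=> [x Dx|v].
  by apply: differentiableD; [exact: f1|exact: g1].
apply: Ck_ext (IH _ _ (f2 v) (g2 v)) => // x Dx.
by rewrite deriveD //; apply: diff_derivable; [exact: f1|exact: g1].
Qed.

End calculus.

Section calculusR.
Variables (R : realType) (V : normedModType R).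
Implicit Types (D : set V) (f g : V -> R) (k : nat).

Lemma CkM k D f g : open D -> Ck k D f -> Ck k D g -> Ck k D (f * g).
Proof.
move=> oD; elim: k f g => [|k IH] f g /=.
  by move=> h1 h2 x Dx; apply: continuousM; [exact: h1|exact: h2].
move=> hf hg; have [f1 f2] := hf; have [g1 g2] := hg; split=> [x Dx|v].
  by apply: differentiableM; [exact: f1|exact: g1].
have := CkD oD (IH _ _ (CkS hf) (g2 v)) (IH _ _ (CkS hg) (f2 v)).
apply: Ck_ext => // x Dx.
by rewrite deriveM //; apply: diff_derivable; [exact: f1|exact: g1].
Qed.

Lemma smooth_sub (W : normedModType R) D D' (f : V -> W) :
  D' `<=` D -> smooth_on D f -> smooth_on D' f.
Proof. by move=> sD h k; exact: Ck_sub (h k). Qed.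

Lemma smooth_ext (W : normedModType R) D (f g : V -> W) :
  open D -> (forall x, D x -> f x = g x) -> smooth_on D f -> smooth_on D g.
Proof. by move=> oD fg h k; exact: Ck_ext (h k). Qed.

Lemma smooth_cst (W : normedModType R) D (c : W) : smooth_on D (fun=> c).
Proof. by move=> k; exact: Ck_cst. Qed.

Lemma smoothD D f g : open D -> smooth_on D f -> smooth_on D g ->
  smooth_on D (fun x => f x + g x).
Proof. by move=> oD hf hg k; exact: CkD. Qed.

Lemma smoothM D f g : open D -> smooth_on D f -> smooth_on D g ->
  smooth_on D (fun x => f x * g x).
Proof. by move=> oD hf hg k; exact: CkM. Qed.

Lemma smoothN D f : open D -> smooth_on D f -> smooth_on D (fun x => - f x).
Proof.
move=> oD hf; apply: smooth_ext (smoothM oD (smooth_cst D (-1 : R)) hf) => //.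
by move=> x _; rewrite mulN1r.
Qed.

Lemma smooth_sum D (I : Type) (r : seq I) (P : pred I) (F : I -> V -> R) :
  open D -> (forall i, smooth_on D (F i)) ->
  smooth_on D (fun x => \sum_(i <- r | P i) F i x).
Proof.
move=> oD h; elim: r => [|i r IH].
  by under eq_fun do rewrite big_nil; exact: smooth_cst.
under eq_fun do rewrite big_cons.
by case: (P i) => //; exact: smoothD.
Qed.

Lemma smooth_derive (W : normedModType R) D (f : V -> W) v :
  smooth_on D f -> smooth_on D ('D_v f).
Proof. by move=> h k; have [_] := h k.+1; exact. Qed.

Lemma smooth_differentiable (W : normedModType R) D (f : V -> W) x :
  smooth_on D f -> D x -> differentiable f x.
Proof. by move=> h Dx; have [+ _] := h 1%N; exact. Qed.

Lemma is_derive_line f (a u : V) (s : R) : derivable f (s *: u + a) u ->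
  is_derive s 1 (fun t : R => f (t *: u + a)) ('D_u f (s *: u + a)).
Proof.
move=> df; have E : (fun h : R => h^-1 *: (((fun t : R => f (t *: u + a)) \o shift s) (h *: (1:R)) - f (s *: u + a)))
   = (fun h : R => h^-1 *: ((f \o shift (s *: u + a)) (h *: u) - f (s *: u + a))).
  by apply/funext => h /=; rewrite [h%:A]mulr1 scalerDl addrA.
by apply: DeriveDef; rewrite /derivable /derive E.
Qed.

Lemma second_difference f (a u v : V) (t : R) : 0 < t ->
  (forall s r, s \in `[0, t] -> r \in `[0, t] ->
     differentiable f (s *: u + r *: v + a) /\
     differentiable ('D_u f) (s *: u + r *: v + a)) ->
  exists s r, [/\ s \in `[0, t], r \in `[0, t] &
    f (t *: u + t *: v + a) - f (t *: u + a) - f (t *: v + a) + f a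
      = t ^+ 2 * 'D_v ('D_u f) (s *: u + r *: v + a)].
Proof.
move=> t0 H.
have t0' : 0 \in `[0, t] by rewrite in_itv /= lexx ltW.
have tt : t \in `[0, t] by rewrite in_itv /= lexx ltW.
have oc x : x \in `]0, t[ -> x \in `[0, t] by exact: subset_itv_oo_cc.
pose phi s := f (s *: u + (t *: v + a)) - f (s *: u + a).
have dphi s : s \in `[0, t] -> is_derive s 1 phi
    ('D_u f (s *: u + (t *: v + a)) - 'D_u f (s *: u + a)).
  move=> sI; apply: is_deriveB; apply: is_derive_line; apply: diff_derivable.
    by rewrite addrA; have [] := H s t sI tt.
  by have [] := H s 0 sI t0'; rewrite scale0r addr0.
have [|s sI E] := MVT t0 (fun s sI => dphi s (oc _ sI)).
  apply/continuous_in_subspaceT => s; rewrite inE /= => sI.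
  by have [d _] := dphi s sI; exact/differentiable_continuous/derivable1_diffP.
pose psi r := 'D_u f (r *: v + (s *: u + a)).
have dpsi r : r \in `[0, t] -> is_derive r 1 psi
    ('D_v ('D_u f) (r *: v + (s *: u + a))).
  move=> rI; apply: is_derive_line; apply: diff_derivable.
  by rewrite addrA [r *: v + _]addrC; have [] := H s r (oc _ sI) rI.
have [|r rI E'] := MVT t0 (fun s sI => dpsi s (oc _ sI)).
  apply/continuous_in_subspaceT => r; rewrite inE /= => rI.
  by have [d _] := dpsi r rI; exact/differentiable_continuous/derivable1_diffP.
exists s, r; split; [exact: oc|exact: oc|].
have P1 : r *: v + (s *: u + a) = s *: u + r *: v + a.
  by rewrite addrA [r *: v + _]addrC.
have P2 : t *: v + (s *: u + a) = s *: u + (t *: v + a) by rewrite addrCA.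
move: E E'; rewrite /phi /psi P1 P2 !scale0r !add0r !subr0 => E E'.
rewrite expr2 -mulrA [t * 'D_v _ _]mulrC -E' mulrC -E.
by rewrite -[t *: u + t *: v + a]addrA [in RHS]opprD opprK !addrA.
Qed.

Lemma schwarz D f x (u v : V) : open D -> Ck 2 D f -> D x ->
  'D_v ('D_u f) x = 'D_u ('D_v f) x.
Proof.
move=> oD [f1 f2] Dx.
have d2 w y : D y -> differentiable ('D_w f) y by have [h _] := f2 w; exact: h.
have c2 w w' : {for x, continuous ('D_w ('D_w' f))}.
  by have [_ h] := f2 w'; exact: (h w x Dx).
apply/eqP; rewrite -subr_eq0 -normr_le0; apply/ler_addgt0Pl => e e0; rewrite addr0.
have e20 : 0 < e / 2 by rewrite divr_gt0.
have near1 : \forall y \near x, [/\ D y,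
    `|'D_v ('D_u f) x - 'D_v ('D_u f) y| < e / 2 &
    `|'D_u ('D_v f) x - 'D_u ('D_v f) y| < e / 2].
  have n1 : nbhs x D by exact: open_nbhs_nbhs.
  have /cvgrPdist_lt/(_ _ e20) n2 := c2 v u.
  have /cvgrPdist_lt/(_ _ e20) n3 := c2 u v.
  exact: (filterS3 _ (fun y h1 h2 h3 => And3 h1 h2 h3) n1 n2 n3).
have /nbhs_ballP[d /= d0 Hd] := near1.
pose N := `|u| + `|v| + 1.
have N0 : 0 < N by rewrite ltr_wpDl // addr_ge0.
pose t := d / 2 / N.
have t0 : 0 < t by rewrite !divr_gt0.
have box s r : s \in `[0, t] -> r \in `[0, t] -> ball x d (s *: u + r *: v + x).
  rewrite !in_itv /= => /andP[s0 st] /andP[r0 rt].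
  rewrite -ball_normE /ball_ /= opprD addrCA subrr addr0 normrN.
  apply: le_lt_trans (ler_normD _ _) _; rewrite !normrZ !ger0_norm //.
  apply: (@le_lt_trans _ _ (t * N)); last first.
    by rewrite /t divfK ?gt_eqF// ltr_pdivrMr// ltr_pMr// ltr1n.
  rewrite /N !mulrDr mulr1 -[leLHS]addr0; apply: lerD; last exact: ltW.
  by apply: lerD; apply: ler_wpM2r.
have [|s1 [r1 [s1I r1I E1]]] := @second_difference f x u v t t0.
  by move=> s r sI rI; have [Dy _ _] := Hd _ (box _ _ sI rI); split; [exact: f1|exact: d2].
have [|r2 [s2 [r2I s2I E2]]] := @second_difference f x v u t t0.
  move=> r s rI sI; rewrite [r *: v + _]addrC.
  by have [Dy _ _] := Hd _ (box _ _ sI rI); split; [exact: f1|exact: d2].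
rewrite [r2 *: v + _]addrC in E2.
have E : 'D_v ('D_u f) (s1 *: u + r1 *: v + x) = 'D_u ('D_v f) (s2 *: u + r2 *: v + x).
  have gen (p q y z : R) : y = t ^+ 2 * p -> z = t ^+ 2 * q -> y = z -> p = q.
    by move=> -> -> /mulfI; apply; rewrite expf_neq0 // gt_eqF.
  apply: gen E1 E2 _.
  by rewrite [t *: v + t *: u]addrC; congr (_ + _); rewrite addrAC.
have [_ H1 _] := Hd _ (box _ _ s1I r1I).
have [_ _ H2] := Hd _ (box _ _ s2I r2I).
have tri (p q y : R) : `|p - y| < e / 2 -> `|q - y| < e / 2 -> `|p - q| <= e.
  move=> h1 h2; have := ler_distD y p q; rewrite (distrC y q) => h3.
  have h4 : `|p - y| + `|q - y| <= e / 2 + e / 2 by exact: lerD (ltW h1) (ltW h2).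
  by rewrite -splitr in h4; exact: le_trans h3 h4.
by apply: (tri _ _ _ H1); rewrite E.
Qed.

End calculusR.

Section multilinear.
Variables (R : realType) (V : lmodType R).

Definition upd k (v : 'I_k -> V) (a : 'I_k) (x : V) : 'I_k -> V :=
  fun b => if b == a then x else v b.

Definition multilinear_map k (w : ('I_k -> V) -> R) : Prop :=
  forall v a, scalar (fun x => w (upd v a x)).

Definition alternating_map k (w : ('I_k -> V) -> R) : Prop :=
  forall v a b, a != b -> v a = v b -> w v = 0.

Section lemmas.
Context {k : nat}.
Implicit Types (v : 'I_k -> V) (w : ('I_k -> V) -> R).

Lemma upd_id v a : upd v a (v a) = v.
Proof. by apply/funext => b; rewrite /upd; case: eqP => // ->. Qed.

Lemma updC v a b x y : a != b -> upd (upd v a x) b y = upd (upd v b y) a x.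
Proof.
move=> ab; apply/funext => c; rewrite /upd; case: eqP => // ->.
by rewrite eq_sym (negPf ab).
Qed.

Lemma multilinearD w v a x y : multilinear_map w ->
  w (upd v a (x + y)) = w (upd v a x) + w (upd v a y).
Proof. by move=> h; have := h v a 1 x y; rewrite scale1r mul1r. Qed.

Lemma multilinear0 w v a : multilinear_map w -> w (upd v a 0) = 0.
Proof.
move=> h; have := multilinearD v a 0 0 h; rewrite addr0 -[LHS]addr0.
by move/addrI.
Qed.

Lemma multilinearZ w v a c x : multilinear_map w ->
  w (upd v a (c *: x)) = c * w (upd v a x).
Proof. by move=> h; have := h v a c x 0; rewrite addr0 multilinear0 // addr0. Qed.

Lemma multilinear_sum w v a (I : Type) (r : seq I) (c : I -> R) (x : I -> V) :
  multilinear_map w ->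
  w (upd v a (\sum_(i <- r) c i *: x i)) = \sum_(i <- r) c i * w (upd v a (x i)).
Proof.
move=> h; elim: r => [|i r IH]; first by rewrite !big_nil multilinear0.
by rewrite !big_cons (h v a) IH.
Qed.

Lemma alt_tperm w v a b : multilinear_map w -> alternating_map w -> a != b ->
  w (v \o tperm a b) = - w v.
Proof.
move=> hm ha ab; apply/eqP; rewrite -addr_eq0; apply/eqP.
pose s := v a + v b.
have h0 x : w (upd (upd v a x) b x) = 0.
  by apply: (ha _ a b) => //; rewrite /upd !eqxx (negPf ab).
have := h0 s; rewrite (multilinearD _ _ _ _ hm) ![upd (upd _ _ s) _ _]updC //.
rewrite !(multilinearD _ _ _ _ hm) -![upd (upd _ b _) a _]updC // !h0 add0r addr0.
rewrite upd_id upd_id addrC => E; rewrite -[RHS]E addrC; congr (_ + _); congr w.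
apply/funext => c; rewrite /upd /=; case: tpermP => [->|->|]; rewrite ?eqxx //.
  by rewrite (negPf ab).
by move=> /eqP/negPf -> /eqP/negPf ->.
Qed.

Lemma alt_perm w v (s : 'S_k) : multilinear_map w -> alternating_map w ->
  w (v \o s) = (-1) ^+ s * w v.
Proof.
move=> hm ha; case: (prod_tpermP s) => ts -> {s}.
elim: ts v => [|[a b] ts IH] v /=.
  by rewrite big_nil odd_perm1 mul1r => _; congr w; apply/funext => c /=; rewrite perm1.
move=> /andP[ab hts]; rewrite big_cons odd_mul_tperm ab /=.
rewrite signrN mulNr.
have -> : v \o (tperm a b * \prod_(t <- ts) tperm t.1 t.2)%g =
  (v \o (\prod_(t <- ts) tperm t.1 t.2)%g) \o tperm a b.
  by apply/funext => c /=; rewrite permM.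
by rewrite alt_tperm // IH.
Qed.

Lemma alt_lift w (x : 'I_k.+1 -> V) (a b : 'I_k.+1) :
  multilinear_map w -> alternating_map w -> a != b -> x a = x b ->
  (-1) ^+ a * w (x \o lift a) = - ((-1) ^+ b * w (x \o lift b)).
Proof.
move=> hm ha ab xab.
have [s Es] : exists s : 'S_k, lift_perm a b s = tperm a b.
  have nz i : lift b (odflt i (unlift b (tperm a b (lift a i)))) = tperm a b (lift a i).
    case: unliftP => [j -> //|/= E].
    have : tperm a b (lift a i) == tperm a b a by rewrite E tpermL.
    by rewrite (inj_eq perm_inj) eq_sym (negPf (neq_lift _ _)).
  have inj : injective (fun i => odflt i (unlift b (tperm a b (lift a i)))).
    by move=> i j /(congr1 (lift b)); rewrite (nz i) (nz j) => /perm_inj/lift_inj.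
  exists (perm inj); apply/permP => i; case: (unliftP a i) => [j ->|->].
    by rewrite lift_perm_lift permE nz.
  by rewrite lift_perm_id tpermL.
have -> : x \o lift a = (x \o lift b) \o s.
  apply/funext => i /=; rewrite -(lift_perm_lift a b s) Es.
  by case: tpermP => // ->; rewrite xab.
rewrite alt_perm // mulrA.
have := congr1 (@odd_perm _) Es; rewrite odd_lift_perm odd_tperm ab.
move=> E; have -> : odd_perm s = ~~ (odd a (+) odd b).
  by move: E; case: (odd_perm s); case: (odd a); case: (odd b).
rewrite -[(-1) ^+ a]signr_odd -[(-1) ^+ b]signr_odd.
by case: (odd a); case: (odd b); rewrite /= ?expr0 ?expr1 ?mulN1r ?mulr1 ?mul1r ?mulNr ?opprK ?mulrN ?mul1r.
Qed.

End lemmas.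

Section wedge.
Variables k l : nat.
Implicit Types (w : ('I_k -> V) -> R) (e : ('I_l -> V) -> R).

(* Normalised so that dx /\ dy = dx (x) dy - dy (x) dx. *)
Definition wedge_alt w e (v : 'I_(k + l) -> V) : R :=
  (k`! * l`!)%:R^-1 * \sum_(s : 'S_(k + l))
     (-1) ^+ s * (w (v \o s \o lshift l) * e (v \o s \o @rshift k l)).

Lemma wedge_multilinear w e : multilinear_map w -> multilinear_map e ->
  multilinear_map (wedge_alt w e).
Proof.
move=> hw he v a c x y; rewrite /wedge_alt [c * _]mulrCA -mulrDr; congr (_ * _).
rewrite mulr_sumr -big_split /=; apply: eq_bigr => s _.
rewrite [c * (_ * _)]mulrCA -mulrDr; congr (_ * _).
have L b z : s (lshift l b) = a ->
    upd v a z \o s \o lshift l = upd (v \o s \o lshift l) b z /\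
    upd v a z \o s \o @rshift k l = v \o s \o @rshift k l.
  move=> E; split; apply/funext => i; rewrite /upd /= -E (inj_eq perm_inj).
    by rewrite (inj_eq (@lshift_inj _ _)).
  by rewrite eq_rlshift.
have Rr b z : s (@rshift k l b) = a ->
    upd v a z \o s \o @rshift k l = upd (v \o s \o @rshift k l) b z /\
    upd v a z \o s \o lshift l = v \o s \o lshift l.
  move=> E; split; apply/funext => i; rewrite /upd /= -E (inj_eq perm_inj).
    by rewrite (inj_eq (@rshift_inj _ _)).
  by rewrite eq_lrshift.
have Ea : s ((s^-1)%g a) = a by rewrite permKV.
move: Ea; case: (split_ordP ((s^-1)%g a)) => b -> Ea.
  have [-> ->] := L b (c *: x + y) Ea; have [-> ->] := L b x Ea.
  have [-> ->] := L b y Ea.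
  by rewrite (hw _ b) mulrDl mulrA.
have [-> ->] := Rr b (c *: x + y) Ea; have [-> ->] := Rr b x Ea.
have [-> ->] := Rr b y Ea.
by rewrite (he _ b) mulrDr mulrCA.
Qed.

Lemma wedge_alternating w e : alternating_map (wedge_alt w e).
Proof.
move=> v a b ab vab; rewrite /wedge_alt.
set S := \sum_s _; suff : S = - S.
  by move/eqP; rewrite -addr_eq0 -mulr2n mulrn_eq0 /= => /eqP ->; rewrite mulr0.
rewrite {1}/S (reindex_inj (mulIg (tperm a b))) /= /S -sumrN.
apply: eq_bigr => s _; rewrite odd_permM odd_tperm ab addbT signrN mulNr.
have -> : v \o (s * tperm a b)%g = v \o s; last by [].
by apply/funext => i /=; rewrite permM; case: tpermP => // ->.
Qed.

End wedge.
End multilinear.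

Section derive_multilinear.
Variables (R : realType) (n : nat).
Notation V := 'rV[R]_n.

Definition fcons k (x : V) (v : 'I_k -> V) : 'I_k.+1 -> V :=
  fun a => if unlift ord0 a is Some b then v b else x.

Lemma fconsE k (v : 'I_k.+1 -> V) : v = fcons (v ord0) (v \o lift ord0).
Proof. by apply/funext => a; rewrite /fcons; case: unliftP => [b|] ->. Qed.

Lemma upd_fcons0 k x y (v : 'I_k -> V) : upd (fcons x v) ord0 y = fcons y v.
Proof.
apply/funext => a; rewrite /upd /fcons; case: unliftP => [b|] ->; last by [].
by rewrite eq_sym (negPf (neq_lift _ _)).
Qed.

Lemma upd_fconsS k x y (v : 'I_k -> V) b :
  upd (fcons x v) (lift ord0 b) y = fcons x (upd v b y).
Proof.
apply/funext => a; rewrite /upd /fcons; case: unliftP => [c|] ->.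
  by rewrite (inj_eq lift_inj).
by rewrite (negPf (neq_lift _ _)).
Qed.

Lemma multilinear_fcons k (w : ('I_k.+1 -> V) -> R) x : multilinear_map w ->
  multilinear_map (fun v => w (fcons x v)).
Proof.
by move=> h v a c y z; have := h (fcons x v) (lift ord0 a) c y z; rewrite !upd_fconsS.
Qed.

Lemma fcons_sum k (w : ('I_k.+1 -> V) -> R) x v : multilinear_map w ->
  w (fcons x v) = \sum_(i < n) x 0 i * w (fcons (delta_mx 0 i) v).
Proof.
move=> h; rewrite -(upd_fcons0 0 x v) {1}[x]row_sum_delta multilinear_sum //.
by apply: eq_bigr => i _; rewrite upd_fcons0.
Qed.

Lemma diff_coord (f : V -> V) y i : differentiable f y ->
  differentiable (fun z => f z 0 i : R) y /\
  (forall u, 'D_u (fun z => f z 0 i : R) y = 'D_u f y 0 i).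
Proof.
move=> df; have dc := @differentiable_coord R 1 n (f y) 0 i.
split=> [|u]; first exact: (differentiable_comp df dc).
rewrite derive_mx; last exact: diff_derivable.
by rewrite mxE.
Qed.

Lemma derive_sumM (I : finType) (c g : I -> V -> R) y :
  (forall i, differentiable (c i) y) -> (forall i, differentiable (g i) y) ->
  differentiable (fun z => \sum_i c i z * g i z) y /\
  forall u, 'D_u (fun z => \sum_i c i z * g i z) y =
    \sum_i (c i y * 'D_u (g i) y + g i y * 'D_u (c i) y).
Proof.
move=> dc dg.
suff H (r : seq I) : differentiable (fun z => \sum_(i <- r) c i z * g i z) y /\
  forall u, 'D_u (fun z => \sum_(i <- r) c i z * g i z) y =
    \sum_(i <- r) (c i y * 'D_u (g i) y + g i y * 'D_u (c i) y) by exact: H.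
elim: r => [|i r [IH1 IH2]].
  under eq_fun do rewrite big_nil; split; first exact: differentiable_cst.
  by move=> u; rewrite big_nil derive_cst.
under eq_fun do rewrite big_cons.
have dM : differentiable (c i * g i) y by exact: differentiableM.
split; first exact: (differentiableD dM IH1).
move=> u; rewrite (deriveD (@diff_derivable _ _ _ _ _ u dM) (@diff_derivable _ _ _ _ _ u IH1)) IH2 big_cons.
by rewrite (deriveM (@diff_derivable _ _ _ _ _ u (dc i)) (@diff_derivable _ _ _ _ _ u (dg i))).
Qed.

Lemma derive_multilinear k (g : V -> ('I_k -> V) -> R) (T : V -> V)
    (w : 'I_k -> V -> V) y :
  (forall z, multilinear_map (g z)) -> differentiable T y ->
  (forall a, differentiable (w a) y) ->
  (forall v, differentiable (g^~ v) (T y)) ->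
  differentiable (fun z => g (T z) (w^~ z)) y /\
  forall u, 'D_u (fun z => g (T z) (w^~ z)) y =
    'D_('D_u T y) (g^~ (w^~ y)) (T y) +
    \sum_b g (T y) (upd (w^~ y) b ('D_u (w b) y)).
Proof.
elim: k g w => [|k IH] g w hm dT dw dg.
  have E z z' : w^~ z = w^~ z' by apply/funext => -[].
  have -> : (fun z => g (T z) (w^~ z)) = g^~ (w^~ y) \o T.
    by apply/funext => z /=; rewrite (E z y).
  have dC : differentiable (g^~ (w^~ y) \o T) y by exact: differentiable_comp.
  split=> // u; rewrite big_ord0 addr0 deriveE // diff_comp //= deriveE //.
  by rewrite deriveE.
pose w' a := w (lift ord0 a).
pose G i z v := g z (fcons (delta_mx 0 i) v).
have hG i z : multilinear_map (G i z) by exact: multilinear_fcons.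
have dG i v : differentiable ((G i)^~ v) (T y) by exact: dg.
have IHG i := IH (G i) w' (hG i) dT (fun a => dw _) (dG i).
have Ew z : w^~ z = fcons (w ord0 z) (w'^~ z) by rewrite [LHS]fconsE.
have EF : (fun z => g (T z) (w^~ z)) =
    (fun z => \sum_i w ord0 z 0 i * G i (T z) (w'^~ z)).
  by apply/funext => z; rewrite Ew fcons_sum.
have dc i : differentiable (fun z => w ord0 z 0 i : R) y by have [] := diff_coord i (dw ord0).
have dg' i : differentiable (fun z => G i (T z) (w'^~ z)) y by have [] := IHG i.
rewrite EF; have [dS HS] := derive_sumM dc dg'; split=> // u; rewrite HS.
have [_ HT] := @derive_sumM _ (fun i _ => w ord0 y 0 i) (fun i => (G i)^~ (w'^~ y)) (T y)
  (fun i => differentiable_cst _ _) (fun i => dG i _).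
have -> : g^~ (w^~ y) = fun z => \sum_i w ord0 y 0 i * G i z (w'^~ y).
  by apply/funext => z; rewrite Ew fcons_sum.
rewrite HT big_ord_recl Ew upd_fcons0 fcons_sum //.
have -> : \sum_(b < k) g (T y) (upd (fcons (w ord0 y) (w'^~ y)) (lift ord0 b)
      ('D_u (w (lift ord0 b)) y)) =
    \sum_i w ord0 y 0 i * \sum_(b < k) G i (T y) (upd (w'^~ y) b ('D_u (w' b) y)).
  under eq_bigr do rewrite upd_fconsS fcons_sum //.
  by rewrite exchange_big; apply: eq_bigr => i _; rewrite mulr_sumr.
rewrite addrCA addrC -addrA -!big_split /=; apply: eq_bigr => i _.
have [_ ->] := IHG i; have [_ ->] := diff_coord i (dw ord0).
rewrite derive_cst mulr0 addr0 mulrDr [G i _ _ * _]mulrC addrA.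
by congr (_ + _); rewrite addrC.
Qed.

End derive_multilinear.

Section local_exterior_derivative.
Variables (R : realType) (n : nat).
Notation V := 'rV[R]_n.

Lemma Ck_coord k (D : set V) (T : V -> V) i : open D -> Ck k D T ->
  Ck k D (fun z => T z 0 i : R).
Proof.
move=> oD; elim: k T => [|k IH] T /=.
  move=> h x Dx; exact: (continuous_comp (h x Dx) (@coord_continuous R 1 n 0 i _)).
move=> [h1 h2]; split=> [x Dx|v]; first by have [] := diff_coord i (h1 x Dx).
apply: Ck_ext (IH _ (h2 v)) => // x Dx.
by have [_ ->] := diff_coord i (h1 x Dx).
Qed.

Lemma schwarz_rV (D : set V) (T : V -> V) x (u v : V) :
  open D -> smooth_on D T -> D x ->
  'D_v ('D_u T) x = 'D_u ('D_v T) x.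
Proof.
move=> oD sT Dx; apply/rowP => i.
have E a b : 'D_a ('D_b T) x 0 i = 'D_a ('D_b (fun z => T z 0 i : R)) x.
  have dT : differentiable ('D_b T) x.
    exact: (smooth_differentiable (smooth_derive b sT) Dx).
  have [_ <-] := diff_coord i dT; apply: near_eq_derive.
  near=> z; have Dz : D z by near: z; exact: open_nbhs_nbhs.
  by have [_ ->] := diff_coord i (smooth_differentiable sT Dz).
have Es := E v u.
have Es' := E u v.
apply: (etrans Es).
apply: (etrans _ (esym Es')).
have cc := Ck_coord i oD (sT 2%N).
exact: (schwarz u v oD cc Dx).
Unshelve. all: by end_near. Qed.

(* (dw)_y(v_0, ..., v_k) = sum_a (-1)^a D_(v_a) [w(v_0, ..^v_a.., v_k)] (y),
   the coordinate formula for the exterior derivative evaluated on constant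
   vector fields of R^n. *)
Definition dloc k (w : V -> ('I_k -> V) -> R) (y : V) (v : 'I_k.+1 -> V) : R :=
  \sum_(a < k.+1) (-1) ^+ a * 'D_(v a) (fun z => w z (v \o lift a)) y.

Lemma deriveMcl (c : R) (f : V -> R) y u : differentiable f y ->
  'D_u (fun z => c * f z) y = c * 'D_u f y.
Proof. by move=> df; rewrite (deriveZ c (@diff_derivable _ _ _ _ _ u df)). Qed.

Lemma upd_lift0 k (v : 'I_k.+1 -> V) b x : upd v b x \o lift b = v \o lift b.
Proof. by apply/funext => i; rewrite /upd /= eq_sym (negPf (neq_lift _ _)). Qed.

Lemma upd_liftS k (v : 'I_k.+1 -> V) a b x :
  upd v (lift a b) x \o lift a = upd (v \o lift a) b x.
Proof. by apply/funext => i; rewrite /upd /= (inj_eq lift_inj). Qed.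

Lemma dloc_multilinear k (w : V -> ('I_k -> V) -> R) y :
  (forall z, multilinear_map (w z)) -> (forall v, differentiable (w^~ v) y) ->
  multilinear_map (dloc w y).
Proof.
move=> hm hd v b c x x'; rewrite /dloc mulr_sumr -big_split /=.
apply: eq_bigr => a _; rewrite [c * _]mulrCA -mulrDr; congr (_ * _).
case: (unliftP a b) => [b'|] ->; last first.
  by rewrite !upd_lift0 /upd eqxx !deriveE // linearP.
have ne x0 : upd v (lift a b') x0 a = v a by rewrite /upd (negPf (neq_lift _ _)).
rewrite !ne !upd_liftS.
have -> : (fun z => w z (upd (v \o lift a) b' (c *: x + x'))) =
  (fun z => c * w z (upd (v \o lift a) b' x)) + w^~ (upd (v \o lift a) b' x').
  by apply/funext => z; rewrite (hm z _ _ c).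
have dc : differentiable (fun z => c * w z (upd (v \o lift a) b' x)) y.
  exact: (@differentiableZ _ _ _ (w^~ (upd (v \o lift a) b' x)) c y (hd _)).
rewrite (deriveD (@diff_derivable _ _ _ _ _ _ dc) (@diff_derivable _ _ _ _ _ _ (hd _))).
by rewrite deriveMcl.
Qed.

Lemma dloc_alternating k (w : V -> ('I_k -> V) -> R) y :
  (forall z, multilinear_map (w z)) -> (forall z, alternating_map (w z)) ->
  (forall v, differentiable (w^~ v) y) ->
  alternating_map (dloc w y).
Proof.
move=> hm ha hd v a b ab vab; rewrite /dloc (bigD1 a) //= (bigD1 b) 1?eq_sym //=.
rewrite big1 ?addr0 => [|c /andP[ca cb]]; last first.
  suff -> : (fun z => w z (v \o lift c)) = cst 0 by rewrite derive_cst mulr0.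
  apply/funext => z.
  have [[a' Ea] [b' Eb]] : (exists a', a = lift c a') /\ (exists b', b = lift c b').
    split; [case: (unliftP c a) => [a' ->|E] | case: (unliftP c b) => [a' ->|E]].
    - by exists a'.
    - by rewrite E eqxx in ca.
    - by exists a'.
    - by rewrite E eqxx in cb.
  apply: (ha z _ a' b'); last by rewrite /= -Ea -Eb.
  by apply: contraNneq ab => E; rewrite Ea Eb E.
have -> : (fun z => w z (v \o lift a)) =
    (fun z => (- ((-1) ^+ a * (-1) ^+ b)) * w z (v \o lift b)).
  apply/funext => z; have := alt_lift (hm z) (ha z) ab vab.
  move/(congr1 (fun t => (-1) ^+ a * t)); rewrite mulrA -expr2 sqrr_sign mul1r => ->.
  by rewrite mulrN mulrA mulNr.
rewrite deriveMcl // vab mulNr mulrN !mulrA -expr2 sqrr_sign mul1r.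
by rewrite addrC subrr.
Qed.

Lemma second_order_cancel k (w : ('I_k -> V) -> R) (W : 'I_k.+1 -> V)
    (S : 'I_k.+1 -> 'I_k.+1 -> V) :
  multilinear_map w -> alternating_map w -> (forall a b, S a b = S b a) ->
  \sum_(a < k.+1) (-1) ^+ a *
    (\sum_(b < k) w (upd (W \o lift a) b (S a (lift a b)))) = 0 :> R.
Proof.
move=> hm ha symS.
pose x (a c : 'I_k.+1) := upd (upd W a (S a c)) c (S a c).
pose G (a c : 'I_k.+1) : R := if a == c then 0 else (-1) ^+ a * w (x a c \o lift a).
have GN a c : G a c = - G c a.
  rewrite /G [c == a]eq_sym; case: eqVneq => [|ac]; first by rewrite oppr0.
  have -> : x c a = x a c by rewrite /x symS updC // eq_sym.
  by apply: alt_lift => //; rewrite /x /upd !eqxx (negPf ac).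
have -> : \sum_(a < k.+1) (-1) ^+ a *
    (\sum_(b < k) w (upd (W \o lift a) b (S a (lift a b)))) =
    \sum_a \sum_c G a c.
  apply: eq_bigr => a _; rewrite (bigD1_ord a) //= {1}/G eqxx add0r mulr_sumr.
  apply: eq_bigr => b _; rewrite /G (negPf (neq_lift _ _)) /x upd_liftS.
  by rewrite upd_lift0.
set s := LHS; suff : s = - s.
  by move/eqP; rewrite -addr_eq0 -mulr2n mulrn_eq0 /= => /eqP.
rewrite {1}/s exchange_big /= /s -sumrN; apply: eq_bigr => a _.
by rewrite -sumrN; apply: eq_bigr => c _; exact: GN.
Qed.

Lemma dloc_pullback k (O : set V) (T : V -> V) (w w' : V -> ('I_k -> V) -> R) y v :
  open O -> smooth_on O T -> O y ->
  (forall z, multilinear_map (w' z)) -> (forall z, alternating_map (w' z)) ->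
  (forall u, differentiable (w'^~ u) (T y)) ->
  (forall z u, O z -> w z u = w' (T z) (fun a => 'D_(u a) T z)) ->
  dloc w y v = dloc w' (T y) (fun a => 'D_(v a) T y).
Proof.
move=> oO sT Oy hm ha hd E.
have dT : differentiable T y by exact: smooth_differentiable sT Oy.
pose W (c : 'I_k.+1) := 'D_(v c) T y.
pose S (a b : 'I_k.+1) := 'D_(v a) ('D_(v b) T) y.
have symS a b : S a b = S b a by exact: (schwarz_rV (v b) (v a) oO sT Oy).
rewrite -[RHS]addr0 -(second_order_cancel W (hm (T y)) (ha (T y)) symS).
rewrite /dloc -big_split /=; apply: eq_bigr => a _; rewrite -mulrDr; congr (_ * _).
pose wf (b : 'I_k) := 'D_(v (lift a b)) T.
have dw b : differentiable (wf b) y.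
  exact: (smooth_differentiable (smooth_derive _ sT) Oy).
have [_ H] := derive_multilinear hm dT dw hd.
transitivity ('D_(v a) (fun z => w' (T z) (wf^~ z)) y).
  apply: near_eq_derive; near=> z; have Oz : O z by near: z; exact: open_nbhs_nbhs.
  by rewrite E.
by rewrite H.
Unshelve. all: by end_near. Qed.

Lemma smooth_dloc k (D : set V) (w : V -> ('I_k -> V) -> R) v :
  open D -> (forall u, smooth_on D (w^~ u)) -> smooth_on D (fun y => dloc w y v).
Proof.
move=> oD h; apply: smooth_sum => // a; apply: smoothM => //.
  exact: smooth_cst.
exact: smooth_derive.
Qed.

End local_exterior_derivative.

Local Open Scope quotient_scope.
Section tensor.
Variables (A : comPzRingType) (U W : lmodType A).

(* Formal sums of pure tensors, as sequences, modulo the congruence generated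
   by commutativity and A-bilinearity. *)
Inductive tens_rel : seq (U * W) -> seq (U * W) -> Prop :=
| tens_refl s : tens_rel s s
| tens_sym s t : tens_rel s t -> tens_rel t s
| tens_trans s t r : tens_rel s t -> tens_rel t r -> tens_rel s r
| tens_cat s s' t t' : tens_rel s s' -> tens_rel t t' ->
    tens_rel (s ++ t) (s' ++ t')
| tens_comm s t : tens_rel (s ++ t) (t ++ s)
| tens_zero w : tens_rel [:: (0, w)] [::]
| tens_addl u u' w : tens_rel [:: (u + u', w)] [:: (u, w); (u', w)]
| tens_addr u w w' : tens_rel [:: (u, w + w')] [:: (u, w); (u, w')]
| tens_scale a u w : tens_rel [:: (a *: u, w)] [:: (u, a *: w)].

Definition tens_relb : rel (seq (U * W)) := fun s t => `[< tens_rel s t >].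

Lemma tens_relb_equiv : equiv_class_of tens_relb.
Proof.
split=> [s|s t|s t r]; first exact/asboolP/tens_refl.
  by apply/asboolP/asboolP => /tens_sym.
by move=> /asboolP h1 /asboolP h2; apply/asboolP; exact: tens_trans h1 h2.
Qed.

Canonical tens_relb_equivRel := EquivRelPack tens_relb_equiv.

Definition tensor := {eq_quot tens_relb}.
HB.instance Definition _ := Choice.on tensor.
HB.instance Definition _ : EqQuotient _ tens_relb tensor := EqQuotient.on tensor.

Definition tclass (s : seq (U * W)) : tensor := \pi_tensor s.

Lemma tclassP s t : tclass s = tclass t <-> tens_rel s t.
Proof.
split=> [/eqmodP/asboolP//|h]; apply/eqmodP; exact/asboolP.
Qed.

Lemma tens_ind (Q : tensor -> Prop) : (forall s, Q (tclass s)) -> forall x, Q x.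
Proof. by move=> h x; rewrite -[x]reprK; exact: h. Qed.

Definition tens (u : U) (w : W) : tensor := tclass [:: (u, w)].

Section lift.
Variables (Z : zmodType) (b : U -> W -> Z).
Hypotheses (bDl : forall u u' w, b (u + u') w = b u w + b u' w)
  (bDr : forall u w w', b u (w + w') = b u w + b u w')
  (bZ : forall a u w, b (a *: u) w = b u (a *: w)).

Definition sum_over (s : seq (U * W)) : Z := \sum_(p <- s) b p.1 p.2.

Lemma sum_over_rel s t : tens_rel s t -> sum_over s = sum_over t.
Proof.
rewrite /sum_over; elim=> //.
- by move=> ? ? ? _ -> _ ->.
- by move=> ? ? ? ? _ h1 _ h2; rewrite !big_cat h1 h2.
- by move=> ? ?; rewrite !big_cat /= addrC.
- move=> w; rewrite big_seq1 big_nil /=.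
  by apply: (@addIr _ (b 0 w)); rewrite -bDl !add0r.
- by move=> ? ? ?; rewrite !big_cons !big_nil /= !addr0.
- by move=> ? ? ?; rewrite !big_cons !big_nil /= !addr0.
- by move=> ? ? ?; rewrite !big_seq1 /=.
Qed.

Lemma sum_over_repr s : sum_over (repr (tclass s)) = sum_over s.
Proof. by apply: sum_over_rel; apply/tclassP; rewrite /tclass reprK. Qed.

End lift.

Definition tadd (x y : tensor) : tensor := tclass (repr x ++ repr y).
Definition tscale (a : A) (x : tensor) : tensor :=
  tclass [seq (a *: p.1, p.2) | p <- repr x].
Definition topp (x : tensor) : tensor := tscale (-1) x.

Lemma taddE s t : tadd (tclass s) (tclass t) = tclass (s ++ t).
Proof. by apply/tclassP; apply: tens_cat; apply/tclassP; rewrite /tclass reprK. Qed.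

Lemma tens_rel_scale a s t : tens_rel s t ->
  tens_rel [seq (a *: p.1, p.2) | p <- s] [seq (a *: p.1, p.2) | p <- t].
Proof.
elim=> {s t} /=.
- by move=> s; exact: tens_refl.
- by move=> s t _; exact: tens_sym.
- by move=> s t r _ h1 _; exact: tens_trans.
- by move=> s s' t t' _ h1 _ h2; rewrite !map_cat; exact: tens_cat.
- by move=> s t; rewrite !map_cat; exact: tens_comm.
- by move=> w; rewrite scaler0; exact: tens_zero.
- by move=> u u' w; rewrite scalerDr; exact: tens_addl.
- by move=> u w w'; exact: tens_addr.
- by move=> c u w; rewrite scalerA mulrC -scalerA; exact: tens_scale.
Qed.

Lemma tscaleE a s : tscale a (tclass s) = tclass [seq (a *: p.1, p.2) | p <- s].
Proof. by apply/tclassP/tens_rel_scale/tclassP; rewrite /tclass reprK. Qed.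

Fact taddA : associative tadd.
Proof.
move=> x y z; elim/tens_ind: x => x; elim/tens_ind: y => y; elim/tens_ind: z => z.
by rewrite !taddE catA.
Qed.

Fact taddC : commutative tadd.
Proof.
move=> x y; elim/tens_ind: x => x; elim/tens_ind: y => y.
by rewrite !taddE; apply/tclassP; exact: tens_comm.
Qed.

Fact tadd0 : left_id (tclass [::]) tadd.
Proof. by move=> x; elim/tens_ind: x => x; rewrite taddE. Qed.

Fact tscaleDl x : {morph tscale^~ x : a b / a + b >-> tadd a b}.
Proof.
move=> a b; elim/tens_ind: x => s; rewrite !tscaleE taddE; apply/tclassP.
elim: s => [|[u w] s IH] /=; first exact: tens_refl.
rewrite scalerDl; apply: tens_trans (tens_cat (tens_addl _ _ _) IH) _ => /=.
rewrite -cat1s -[X in tens_rel _ X]cat1s; apply: tens_cat; first exact: tens_refl.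
have := tens_cat (tens_comm [:: (b *: u, w)] [seq (a *: p.1, p.2) | p <- s])
  (tens_refl [seq (b *: p.1, p.2) | p <- s]).
by rewrite -!catA.
Qed.

Fact tscale0 x : tscale 0 x = tclass [::].
Proof.
elim/tens_ind: x => s; rewrite tscaleE; apply/tclassP.
elim: s => [|[u w] s IH] /=; first exact: tens_refl.
by rewrite scale0r -cat1s; exact: (tens_cat (tens_zero w) IH).
Qed.

Fact tscale1 : left_id 1 tscale.
Proof.
move=> x; elim/tens_ind: x => s; rewrite tscaleE; congr tclass.
by rewrite -[RHS]map_id; apply: eq_map => -[u w] /=; rewrite scale1r.
Qed.

Fact taddN : left_inverse (tclass [::]) topp tadd.
Proof. by move=> x; rewrite -{2}[x]tscale1 -tscaleDl addNr tscale0. Qed.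

HB.instance Definition _ := GRing.isZmodule.Build tensor taddA taddC tadd0 taddN.

Fact tscaleA a b x : tscale a (tscale b x) = tscale (a * b) x.
Proof.
elim/tens_ind: x => s; rewrite !tscaleE -map_comp; congr tclass.
by apply: eq_map => -[u w] /=; rewrite scalerA.
Qed.

Fact tscaleDr : right_distributive tscale +%R.
Proof.
move=> a x y; elim/tens_ind: x => s; elim/tens_ind: y => t.
by rewrite -[tclass s + _]/(tadd _ _) !taddE !tscaleE -[RHS]/(tadd _ _) taddE map_cat.
Qed.

HB.instance Definition _ :=
  GRing.Zmodule_isLmodule.Build A tensor tscaleA tscale1 tscaleDr tscaleDl.

Lemma tensDl u u' w : tens (u + u') w = tens u w + tens u' w.
Proof. by rewrite -[RHS]/(tadd _ _) taddE; apply/tclassP; exact: tens_addl. Qed.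

Lemma tensDr u w w' : tens u (w + w') = tens u w + tens u w'.
Proof. by rewrite -[RHS]/(tadd _ _) taddE; apply/tclassP; exact: tens_addr. Qed.

Lemma tensZl a u w : tens (a *: u) w = a *: tens u w.
Proof. by rewrite -[RHS]/(tscale _ _) tscaleE. Qed.

Lemma tensZr a u w : tens u (a *: w) = a *: tens u w.
Proof. by rewrite -tensZl; apply/esym/tclassP; exact: tens_scale. Qed.

Lemma tensor_ind (Q : tensor -> Prop) : Q 0 ->
  (forall u w x, Q x -> Q (tens u w + x)) -> forall x, Q x.
Proof.
move=> h0 h x; elim/tens_ind: x; elim=> [|[u w] s IH]; first exact: h0.
by have := h u w _ IH; rewrite -[_ + _]/(tadd _ _) taddE.
Qed.

Definition tlift (Z : zmodType) (b : U -> W -> Z) (x : tensor) : Z :=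
  \sum_(p <- repr x) b p.1 p.2.

Section liftE.
Variables (Z : zmodType) (b : U -> W -> Z).
Hypotheses (bDl : forall u u' w, b (u + u') w = b u w + b u' w)
  (bDr : forall u w w', b u (w + w') = b u w + b u w')
  (bZ : forall a u w, b (a *: u) w = b u (a *: w)).

Lemma tlift_tens u w : tlift b (tens u w) = b u w.
Proof. by rewrite -[LHS]/(sum_over b _) sum_over_repr // /sum_over big_seq1. Qed.

Lemma tliftD x y : tlift b (x + y) = tlift b x + tlift b y.
Proof.
elim/tens_ind: x => s; elim/tens_ind: y => t.
rewrite -[tclass s + _]/(tadd _ _) taddE -[LHS]/(sum_over b _) -[tlift b (tclass s)]/(sum_over b _) -[tlift b (tclass t)]/(sum_over b _).
by rewrite !sum_over_repr // /sum_over big_cat.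
Qed.

End liftE.
End tensor.
Local Close Scope quotient_scope.

(* A Hausdorff second countable space with a smooth atlas of dimension n:
   chart i is a homeomorphism from the open set cdom i onto the open set cim i of
   R^n, with inverse param i; the values of chart i outside cdom i, and of
   param i outside cim i, are irrelevant. *)
Record manifold (R : realType) (n : nat) := Manifold {
  carrier :> topologicalType;
  chart_index : Type;
  cdom : chart_index -> set carrier;
  cim : chart_index -> set 'rV[R]_n;
  chart : chart_index -> carrier -> 'rV[R]_n;
  param : chart_index -> 'rV[R]_n -> carrier;
  carrier_hausdorff : hausdorff_space carrier;
  carrier_second_countable : @second_countable carrier;
  dom_open : forall i, open (cdom i);
  dom_cover : forall x, exists i, cdom i x;
  im_open : forall i, open (cim i);
  chart_im : forall i x, cdom i x -> cim i (chart i x);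
  param_dom : forall i y, cim i y -> cdom i (param i y);
  chartK : forall i x, cdom i x -> param i (chart i x) = x;
  paramK : forall i y, cim i y -> chart i (param i y) = y;
  chart_continuous : forall i x, cdom i x -> {for x, continuous (chart i)};
  param_continuous : forall i y, cim i y -> {for y, continuous (param i)};
  transition_smooth : forall i j,
    smooth_on (cim i `&` param i @^-1` cdom j) (chart j \o param i)
}.

Section smooth_functions.
Variables (R : realType) (n : nat) (M : manifold R n).
Notation V := 'rV[R]_n.

(* Smoothness on an open subset U of M, read in every chart. *)
Definition smooth_mfun (U : set M) (f : M -> R) : Prop :=
  forall i, smooth_on (cim i `&` @param _ _ M i @^-1` U) (f \o param i).

Lemma open_local i (U : set M) : open U ->
  open (@cim _ _ M i `&` @param _ _ M i @^-1` U).
Proof.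
move=> oU; rewrite openE => y [iy Uy].
apply: filterI; first by apply: open_nbhs_nbhs; split=> //; exact: im_open.
by apply: (param_continuous iy); exact: open_nbhs_nbhs.
Qed.

Lemma smooth_mfun_ext (U : set M) f g : open U -> (forall x, U x -> f x = g x) ->
  smooth_mfun U f -> smooth_mfun U g.
Proof.
move=> oU fg h i; apply: smooth_ext (h i); first exact: open_local.
by move=> y [_ Uy]; exact: fg.
Qed.

Lemma smooth_mfun_sub (U U' : set M) f : U' `<=` U -> smooth_mfun U f -> smooth_mfun U' f.
Proof. by move=> s h i; apply: smooth_sub (h i) => y [iy /s Uy]. Qed.

Lemma smooth_mfun_cst U c : smooth_mfun U (fun=> c).
Proof. by move=> i; exact: smooth_cst. Qed.

Lemma smooth_mfunD U f g : open U -> smooth_mfun U f -> smooth_mfun U g ->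
  smooth_mfun U (fun x => f x + g x).
Proof. by move=> oU hf hg i; apply: smoothD (hf i) (hg i); exact: open_local. Qed.

Lemma smooth_mfunM U f g : open U -> smooth_mfun U f -> smooth_mfun U g ->
  smooth_mfun U (fun x => f x * g x).
Proof. by move=> oU hf hg i; apply: smoothM (hf i) (hg i); exact: open_local. Qed.

Lemma smooth_mfunN U f : open U -> smooth_mfun U f -> smooth_mfun U (fun x => - f x).
Proof. by move=> oU hf i; apply: smoothN (hf i); exact: open_local. Qed.

Lemma smooth_mfun_sum U (I : Type) (r : seq I) (P : pred I) (F : I -> M -> R) :
  open U -> (forall i, smooth_mfun U (F i)) ->
  smooth_mfun U (fun x => \sum_(i <- r | P i) F i x).
Proof.
move=> oU h i; apply: (@smooth_sum _ _ _ _ r P (fun j => F j \o param i)).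
  exact: open_local.
by move=> j; exact: h.
Qed.

(* Omega^0(M). *)
Record sfun := SFun { sfun_val :> M -> R; sfunP : smooth_mfun setT sfun_val }.

Lemma sfun_ext (f g : sfun) : (forall x, f x = g x) -> f = g.
Proof.
case: f g => [f hf] [g hg] /= /funext E; subst g; congr SFun.
exact: Prop_irrelevance.
Qed.

HB.instance Definition _ := gen_eqMixin sfun.
HB.instance Definition _ := gen_choiceMixin sfun.

Definition sfun_cst c := SFun (smooth_mfun_cst setT c).
Definition sfun_add (f g : sfun) := SFun (smooth_mfunD openT (sfunP f) (sfunP g)).
Definition sfun_mul (f g : sfun) := SFun (smooth_mfunM openT (sfunP f) (sfunP g)).
Definition sfun_opp (f : sfun) := SFun (smooth_mfunN openT (sfunP f)).

Fact sfun_addA : associative sfun_add.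
Proof. by move=> f g h; apply: sfun_ext => x /=; rewrite addrA. Qed.
Fact sfun_addC : commutative sfun_add.
Proof. by move=> f g; apply: sfun_ext => x /=; rewrite addrC. Qed.
Fact sfun_add0 : left_id (sfun_cst 0) sfun_add.
Proof. by move=> f; apply: sfun_ext => x /=; rewrite add0r. Qed.
Fact sfun_addN : left_inverse (sfun_cst 0) sfun_opp sfun_add.
Proof. by move=> f; apply: sfun_ext => x /=; rewrite addNr. Qed.
HB.instance Definition _ :=
  GRing.isZmodule.Build sfun sfun_addA sfun_addC sfun_add0 sfun_addN.

Fact sfun_mulA : associative sfun_mul.
Proof. by move=> f g h; apply: sfun_ext => x /=; rewrite mulrA. Qed.
Fact sfun_mulC : commutative sfun_mul.
Proof. by move=> f g; apply: sfun_ext => x /=; rewrite mulrC. Qed.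
Fact sfun_mul1 : left_id (sfun_cst 1) sfun_mul.
Proof. by move=> f; apply: sfun_ext => x /=; rewrite mul1r. Qed.
Fact sfun_mulDl : left_distributive sfun_mul sfun_add.
Proof. by move=> f g h; apply: sfun_ext => x /=; rewrite mulrDl. Qed.
HB.instance Definition _ :=
  GRing.Zmodule_isComPzRing.Build sfun sfun_mulA sfun_mulC sfun_mul1 sfun_mulDl.

End smooth_functions.

Section forms.
#[local] Obligation Tactic := cbv beta.
Variables (R : realType) (n : nat) (M : manifold R n).
Notation V := 'rV[R]_n.

(* A k-form on M is a family of smooth k-forms w_i on the chart images cim i, one
   for each chart, related by pullback along the changes of coordinates:
   w_i = (chart_j o param_i)^* w_j. Here 'D_(v a) (chart j \o param i) y is the
   image of v a under the differential at y. Setting w_i to 0 outside cim i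
   makes Leibniz equality the equality of forms. *)
Record diff_form (k : nat) := DiffForm {
  form_val :> chart_index M -> V -> ('I_k -> V) -> R;
  form_off : forall i y v, ~ cim i y -> form_val i y v = 0;
  form_multilinear : forall i y, multilinear_map (form_val i y);
  form_alternating : forall i y, alternating_map (form_val i y);
  form_smooth : forall i v, smooth_on (cim i) (fun y => form_val i y v);
  form_compat : forall i j y v, cim i y -> cdom j (param i y) ->
    form_val i y v =
    form_val j (chart j (param i y)) (fun a => 'D_(v a) (chart j \o param i) y)
}.

Lemma form_ext k (w e : diff_form k) :
  (forall i y v, cim i y -> w i y v = e i y v) -> w = e.
Proof.
move=> E; have {}E : form_val w = form_val e.
  apply/funext => i; apply/funext => y; apply/funext => v.
  by have [iy|niy] := pselect (cim i y); [exact: E|rewrite !form_off].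
case: w e E => [w h1 h2 h3 h4 h5] [e h1' h2' h3' h4' h5'] /= E; subst e.
by congr DiffForm; exact: Prop_irrelevance.
Qed.

Lemma multilinear_cast k m (h : k = m) (w : ('I_k -> V) -> R) :
  multilinear_map w -> multilinear_map (fun v : 'I_m -> V => w (v \o cast_ord h)).
Proof.
subst m => hw; suff -> : (fun v => w (v \o cast_ord (erefl k))) = w by [].
by apply/funext => v; congr w; apply/funext => a /=; rewrite cast_ord_id.
Qed.

Lemma alternating_cast k m (h : k = m) (w : ('I_k -> V) -> R) :
  alternating_map w -> alternating_map (fun v : 'I_m -> V => w (v \o cast_ord h)).
Proof.
subst m => hw; suff -> : (fun v => w (v \o cast_ord (erefl k))) = w by [].
by apply/funext => v; congr w; apply/funext => a /=; rewrite cast_ord_id.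
Qed.

Section module.
Variable k : nat.
HB.instance Definition _ := gen_eqMixin (diff_form k).
HB.instance Definition _ := gen_choiceMixin (diff_form k).

Program Definition form_zero : diff_form k := @DiffForm k (fun _ _ _ => 0) _ _ _ _ _.
Next Obligation. by []. Qed.
Next Obligation. by move=> i y v a c x z; rewrite mulr0 addr0. Qed.
Next Obligation. by []. Qed.
Next Obligation. by move=> i v; exact: smooth_cst. Qed.
Next Obligation. by []. Qed.

Program Definition form_add (w e : diff_form k) : diff_form k :=
  @DiffForm k (fun i y v => w i y v + e i y v) _ _ _ _ _.
Next Obligation. by move=> w e i y v h; rewrite !form_off // addr0. Qed.
Next Obligation.
move=> w e i y v a c x z.
by rewrite (form_multilinear w i y v a) (form_multilinear e i y v a) mulrDr addrACA.
Qed.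
Next Obligation.
move=> w e i y v a b ab vab.
by rewrite (form_alternating _ _ _ ab vab) (form_alternating _ _ _ ab vab) addr0.
Qed.
Next Obligation.
by move=> w e i v; apply: smoothD; [exact: im_open|exact: form_smooth|exact: form_smooth].
Qed.
Next Obligation. by move=> w e i j y v iy jy; rewrite -!form_compat. Qed.

Program Definition form_scale (f : sfun M) (w : diff_form k) : diff_form k :=
  @DiffForm k (fun i y v => f (param i y) * w i y v) _ _ _ _ _.
Next Obligation. by move=> f w i y v h; rewrite form_off // mulr0. Qed.
Next Obligation.
move=> f w i y v a c x z.
by rewrite (form_multilinear w i y v a) mulrDr mulrCA.
Qed.
Next Obligation. by move=> f w i y v a b ab vab; rewrite (form_alternating _ _ _ ab vab) mulr0. Qed.
Next Obligation.
move=> f w i v; apply: smoothM; [exact: im_open| |exact: form_smooth].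
by apply: smooth_sub (sfunP f i) => y iy; split.
Qed.
Next Obligation. by move=> f w i j y v iy jy; rewrite -form_compat // chartK. Qed.

Definition form_opp (w : diff_form k) := form_scale (-1) w.

Fact form_addA : associative form_add.
Proof. by move=> f g h; apply: form_ext => i y v _ /=; rewrite addrA. Qed.
Fact form_addC : commutative form_add.
Proof. by move=> f g; apply: form_ext => i y v _ /=; rewrite addrC. Qed.
Fact form_add0 : left_id form_zero form_add.
Proof. by move=> f; apply: form_ext => i y v _ /=; rewrite add0r. Qed.
Fact form_addN : left_inverse form_zero form_opp form_add.
Proof. by move=> f; apply: form_ext => i y v _ /=; rewrite mulN1r addNr. Qed.
HB.instance Definition _ :=
  GRing.isZmodule.Build (diff_form k) form_addA form_addC form_add0 form_addN.

Fact form_scaleA a b w : form_scale a (form_scale b w) = form_scale (a * b) w.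
Proof. by apply: form_ext => i y v _ /=; rewrite mulrA. Qed.
Fact form_scale1 : left_id 1 form_scale.
Proof. by move=> w; apply: form_ext => i y v _ /=; rewrite mul1r. Qed.
Fact form_scaleDr : right_distributive form_scale +%R.
Proof. by move=> f w e; apply: form_ext => i y v _ /=; rewrite mulrDr. Qed.
Fact form_scaleDl w : {morph form_scale^~ w : a b / a + b}.
Proof. by move=> f g; apply: form_ext => i y v _ /=; rewrite mulrDl. Qed.
HB.instance Definition _ := GRing.Zmodule_isLmodule.Build (sfun M) (diff_form k)
  form_scaleA form_scale1 form_scaleDr form_scaleDl.

End module.

Lemma form_differentiable k (w : diff_form k) i y v : cim i y ->
  differentiable ((w i)^~ v) y.
Proof. by move=> iy; exact: (smooth_differentiable (form_smooth w i v) iy). Qed.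

Section wedge.
Variables (k l : nat) (w : diff_form k) (e : diff_form l).

Program Definition wedge_form : diff_form (k + l) :=
  @DiffForm (k + l) (fun i y v => wedge_alt (w i y) (e i y) v) _ _ _ _ _.
Next Obligation.
move=> i y v h; rewrite /wedge_alt big1 ?mulr0 // => s _.
by rewrite form_off // mul0r mulr0.
Qed.
Next Obligation.
by move=> i y; apply: wedge_multilinear; exact: form_multilinear.
Qed.
Next Obligation. by move=> i y; exact: wedge_alternating. Qed.
Next Obligation.
move=> i v; have oi := @im_open _ _ M i; rewrite /wedge_alt.
apply: smoothM => //; first exact: smooth_cst.
apply: smooth_sum => // s; apply: smoothM => //; first exact: smooth_cst.
by apply: smoothM => //; exact: form_smooth.
Qed.
Next Obligation.
move=> i j y v iy jy; rewrite /wedge_alt; congr (_ * _); apply: eq_bigr => s _.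
by rewrite !(form_compat _ _ iy jy).
Qed.

End wedge.

(* The identification of Omega^0(M) with the 0-forms. *)
Program Definition form_of_sfun (f : sfun M) : diff_form 0 :=
  @DiffForm 0 (fun i y _ => if `[< cim i y >] then f (param i y) else 0) _ _ _ _ _.
Next Obligation. by move=> f i y v; case: asboolP. Qed.
Next Obligation. by move=> f i y v []. Qed.
Next Obligation. by move=> f i y v []. Qed.
Next Obligation.
move=> f i _; have oi := @im_open _ _ M i.
apply: (@smooth_ext _ _ _ _ (f \o param i)) => //.
  by move=> y iy /=; rewrite asboolT.
by apply: smooth_sub (sfunP f i) => y iy; split.
Qed.
Next Obligation.
move=> f i j y v iy jy; rewrite !asboolT //; last exact: chart_im.
by rewrite chartK.
Qed.

Program Definition extd k (w : diff_form k) : diff_form (k + 1) :=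
  @DiffForm (k + 1) (fun i y v => if `[< cim i y >]
     then dloc (w i) y (v \o cast_ord (esym (addn1 k))) else 0) _ _ _ _ _.
Next Obligation. by move=> k w i y v; case: asboolP. Qed.
Next Obligation.
move=> k w i y; case: asboolP => iy; last by move=> v a c x z; rewrite mulr0 addr0.
apply: (@multilinear_cast _ _ (esym (addn1 k)) (dloc (w i) y)).
apply: dloc_multilinear => [z|v]; first exact: form_multilinear.
exact: form_differentiable.
Qed.
Next Obligation.
move=> k w i y; case: asboolP => iy; last by [].
apply: (@alternating_cast _ _ (esym (addn1 k)) (dloc (w i) y)).
apply: dloc_alternating => [z|z|v]; first exact: form_multilinear.
  exact: form_alternating.
exact: form_differentiable.
Qed.
Next Obligation.
move=> k w i v; have oi := @im_open _ _ M i.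
apply: (@smooth_ext _ _ _ _
  (fun y => dloc (w i) y (v \o cast_ord (esym (addn1 k))))) => //.
  by move=> y iy /=; rewrite asboolT.
by apply: smooth_dloc => // u; exact: form_smooth.
Qed.
Next Obligation.
move=> k w i j y v iy jy; rewrite !asboolT //; last exact: chart_im.
apply: (@dloc_pullback _ _ _ (cim i `&` param i @^-1` cdom j)).
- exact: open_local (dom_open j).
- exact: transition_smooth.
- by [].
- by move=> z; exact: form_multilinear.
- by move=> z; exact: form_alternating.
- by move=> u; apply: form_differentiable; exact: chart_im.
- by move=> z u [iz jz]; exact: form_compat.
Qed.

End forms.

Section wedge_bilinear.
Variables (R : realType) (n : nat) (M : manifold R n) (k l : nat).
Implicit Types (w : diff_form M k) (e : diff_form M l) (f : sfun M).

Lemma wedgeDl w w' e : wedge_form (w + w') e = wedge_form w e + wedge_form w' e.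
Proof.
apply: form_ext => i y v _ /=; rewrite /wedge_alt -mulrDr; congr (_ * _).
by rewrite -big_split; apply: eq_bigr => s _ /=; rewrite mulrDl mulrDr.
Qed.

Lemma wedgeDr w e e' : wedge_form w (e + e') = wedge_form w e + wedge_form w e'.
Proof.
apply: form_ext => i y v _ /=; rewrite /wedge_alt -mulrDr; congr (_ * _).
by rewrite -big_split; apply: eq_bigr => s _ /=; rewrite !mulrDr.
Qed.

Lemma wedgeZl f w e : wedge_form (f *: w) e = f *: wedge_form w e.
Proof.
apply: form_ext => i y v _ /=; rewrite /wedge_alt mulrCA; congr (_ * _).
by rewrite mulr_sumr; apply: eq_bigr => s _ /=; rewrite -mulrA mulrCA.
Qed.

Lemma wedgeZr f w e : wedge_form w (f *: e) = f *: wedge_form w e.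
Proof.
apply: form_ext => i y v _ /=; rewrite /wedge_alt mulrCA; congr (_ * _).
by rewrite mulr_sumr; apply: eq_bigr => s _ /=; rewrite [RHS]mulrCA; congr (_ * _); rewrite mulrCA.
Qed.

End wedge_bilinear.

(* A smooth vector bundle, given by its fibres and a family of local
   trivialisations whose transition functions are smooth; the total space is
   {x & fibre x} with the structure making the trivialisations diffeomorphisms.
   The rank is constant on connected components but need not be globally
   constant. *)
Record vector_bundle (R : realType) (n : nat) (M : manifold R n) := VectorBundle {
  fibre :> M -> lmodType R;
  triv_index : Type;
  brank : triv_index -> nat;
  tdom : triv_index -> set M;
  triv : forall i x, fibre x -> 'rV[R]_(brank i);
  trivV : forall i x, 'rV[R]_(brank i) -> fibre x;
  tdom_open : forall i, open (tdom i);
  tdom_cover : forall x, exists i, tdom i x;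
  triv_linear : forall i x, tdom i x -> linear (@triv i x);
  trivK : forall i x, tdom i x -> cancel (@triv i x) (@trivV i x);
  trivVK : forall i x, tdom i x -> cancel (@trivV i x) (@triv i x);
  triv_smooth : forall i j a b, smooth_mfun (tdom i `&` tdom j)
    (fun x => @triv j x (@trivV i x (delta_mx 0 a)) 0 b)
}.

Arguments triv {R n M v} i [x] u.
Arguments trivV {R n M v} i x u.

Section sections.
Variables (R : realType) (n : nat) (M : manifold R n) (xi : vector_bundle M).

(* Omega^0(xi). *)
Record smooth_section := SmoothSection {
  section_val :> forall x, xi x;
  sectionP : forall i b,
    smooth_mfun (tdom i) (fun x => triv i (section_val x) 0 b)
}.

Lemma section_ext (s t : smooth_section) : (forall x, s x = t x) -> s = t.
Proof.
case: s t => [s hs] [t ht] /= E; have {}E : s = t by exact: functional_extensionality_dep.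
by subst t; congr SmoothSection; exact: Prop_irrelevance.
Qed.

HB.instance Definition _ := gen_eqMixin smooth_section.
HB.instance Definition _ := gen_choiceMixin smooth_section.

Lemma trivP i x (h : tdom i x) c (u v : xi x) b :
  triv i (c *: u + v) 0 b = c * triv i u 0 b + triv i v 0 b.
Proof. by rewrite (triv_linear h) !mxE. Qed.

Lemma triv0 i x (h : tdom i x) b : triv i (0 : xi x) 0 b = 0.
Proof.
have := trivP h 1 0 0 b; rewrite scale1r addr0 mul1r -[LHS]addr0.
by move/addrI.
Qed.

#[local] Obligation Tactic := cbv beta.

Program Definition section_zero : smooth_section := @SmoothSection (fun x => 0) _.
Next Obligation.
move=> i b; apply: (@smooth_mfun_ext _ _ _ _ (fun=> 0)); first exact: tdom_open.
  by move=> x ix; rewrite triv0.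
exact: smooth_mfun_cst.
Qed.

Program Definition section_add (s t : smooth_section) : smooth_section :=
  @SmoothSection (fun x => s x + t x) _.
Next Obligation.
move=> s t i b.
apply: (@smooth_mfun_ext _ _ _ _ (fun x => triv i (s x) 0 b + triv i (t x) 0 b)).
- exact: tdom_open.
- by move=> x ix; rewrite -{2}[s x]scale1r trivP // mul1r.
- by apply: smooth_mfunD; [exact: tdom_open|exact: sectionP|exact: sectionP].
Qed.

Program Definition section_scale (f : sfun M) (s : smooth_section) : smooth_section :=
  @SmoothSection (fun x => f x *: s x) _.
Next Obligation.
move=> f s i b; apply: (@smooth_mfun_ext _ _ _ _ (fun x => f x * triv i (s x) 0 b)).
- exact: tdom_open.
- by move=> x ix; rewrite -[_ *: _]addr0 trivP // triv0 // addr0.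
- apply: smooth_mfunM; [exact: tdom_open| |exact: sectionP].
  by apply: smooth_mfun_sub (sfunP f).
Qed.

Definition section_opp (s : smooth_section) := section_scale (-1) s.

Fact section_addA : associative section_add.
Proof. by move=> f g h; apply: section_ext => x /=; rewrite addrA. Qed.
Fact section_addC : commutative section_add.
Proof. by move=> f g; apply: section_ext => x /=; rewrite addrC. Qed.
Fact section_add0 : left_id section_zero section_add.
Proof. by move=> f; apply: section_ext => x /=; rewrite add0r. Qed.
Fact section_addN : left_inverse section_zero section_opp section_add.
Proof. by move=> f; apply: section_ext => x /=; rewrite scaleN1r addNr. Qed.
HB.instance Definition _ :=
  GRing.isZmodule.Build smooth_section section_addA section_addC section_add0 section_addN.

Fact section_scaleA a b s : section_scale a (section_scale b s) = section_scale (a * b) s.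
Proof. by apply: section_ext => x /=; rewrite scalerA. Qed.
Fact section_scale1 : left_id 1 section_scale.
Proof. by move=> s; apply: section_ext => x /=; rewrite scale1r. Qed.
Fact section_scaleDr : right_distributive section_scale +%R.
Proof. by move=> f s t; apply: section_ext => x /=; rewrite scalerDr. Qed.
Fact section_scaleDl s : {morph section_scale^~ s : a b / a + b}.
Proof. by move=> f g; apply: section_ext => x /=; rewrite scalerDl. Qed.
HB.instance Definition _ := GRing.Zmodule_isLmodule.Build (sfun M) smooth_section
  section_scaleA section_scale1 section_scaleDr section_scaleDl.

(* HOM(xi, xi): fibrewise linear, with smooth matrix in each trivialisation. *)
Record bundle_endo := BundleEndo {
  endo_val :> forall x, xi x -> xi x;
  endo_linear : forall x, linear (@endo_val x);
  endo_smooth : forall i a b, smooth_mfun (tdom i)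
    (fun x => triv i (@endo_val x (trivV i x (delta_mx 0 a))) 0 b)
}.

Program Definition endo_section (P : bundle_endo) (s : smooth_section) : smooth_section :=
  @SmoothSection (fun x => P x (s x)) _.
Next Obligation.
move=> P s i b.
apply: (@smooth_mfun_ext _ _ _ _ (fun x => \sum_(a < brank i)
  triv i (s x) 0 a * triv i (P x (trivV i x (delta_mx 0 a))) 0 b)).
- exact: tdom_open.
- move=> x ix.
  pose L (u : 'rV[R]_(brank i)) := triv i (P x (trivV i x u)) 0 b.
  have LL : scalar L.
    move=> c u v; rewrite /L -(trivP ix) -(endo_linear P); congr (triv i (P x _) 0 b).
    apply: (can_inj (trivK ix)).
    by rewrite (triv_linear ix) !trivVK.
  have L0 : L 0 = 0.
    by have := LL 1 0 0; rewrite scale1r addr0 mul1r -[LHS]addr0 => /addrI.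
  have Ls (r : seq 'I_(brank i)) (c : 'I_(brank i) -> R) (u : 'I_(brank i) -> 'rV[R]_(brank i)) :
      L (\sum_(j <- r) c j *: u j) = \sum_(j <- r) c j * L (u j).
    by elim: r => [|j r IH]; rewrite ?big_nil // !big_cons LL IH.
  by rewrite -Ls -row_sum_delta /L trivK.
- apply: smooth_mfun_sum => [|a]; first exact: tdom_open.
  by apply: smooth_mfunM; [exact: tdom_open|exact: sectionP|exact: endo_smooth].
Qed.

Lemma endo_section_linear P : linear (endo_section P).
Proof. by move=> f s t; apply: section_ext => x /=; rewrite (endo_linear P). Qed.

Definition Omega (k : nat) : lmodType (sfun M) :=
  if k is k'.+1 then tensor (diff_form M k'.+1) smooth_section else smooth_section.

(* P(w (x) s) = w (x) P(s); see act_tens. *)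
Definition endo_act (P : bundle_endo) (k : nat) : Omega k -> Omega k :=
  match k return Omega k -> Omega k with
  | 0%N => endo_section P
  | k'.+1 => tlift (fun (w : diff_form M k'.+1) (s : smooth_section) => tens w (endo_section P s))
  end.

(* b /\ (w (x) s) = (b /\ w) (x) s; see wedgeT_tens. *)
Definition wedgeT (k l : nat) (w : diff_form M k) :
    tensor (diff_form M l) smooth_section -> tensor (diff_form M (k + l)) smooth_section :=
  tlift (fun (e : diff_form M l) s => tens (wedge_form w e) s).

Lemma endo_sectionD P (s t : smooth_section) :
  endo_section P (s + t) = endo_section P s + endo_section P t.
Proof. by have := endo_section_linear P 1 s t; rewrite !scale1r. Qed.

Lemma endo_sectionZ P f (s : smooth_section) :
  endo_section P (f *: s) = f *: endo_section P s.
Proof.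
have E0 : endo_section P 0 = 0.
  by have := endo_sectionD P 0 0; rewrite addr0 -{1}[endo_section P 0]addr0 => /addrI.
by have := endo_section_linear P f s 0; rewrite E0 !addr0.
Qed.

Lemma act_tens P k (w : diff_form M k.+1) (s : smooth_section) :
  endo_act P (k := k.+1) (tens w s) = tens w (endo_section P s).
Proof.
apply: (tlift_tens (b := fun (w : diff_form M k.+1) s => tens w (endo_section P s))).
- by move=> u u' t; rewrite tensDl.
- by move=> u t t'; rewrite endo_sectionD tensDr.
- by move=> f u t; rewrite endo_sectionZ tensZl tensZr.
Qed.

Lemma actD P k (x y : Omega k) : endo_act P (x + y) = endo_act P x + endo_act P y.
Proof.
case: k x y => [|k] x y; first exact: endo_sectionD.
apply: (tliftD (b := fun (w : diff_form M k.+1) s => tens w (endo_section P s))).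
- by move=> u u' t; rewrite tensDl.
- by move=> u t t'; rewrite endo_sectionD tensDr.
- by move=> f u t; rewrite endo_sectionZ tensZl tensZr.
Qed.

Lemma wedgeT_tens k l (w : diff_form M k) (e : diff_form M l) (s : smooth_section) :
  wedgeT w (tens e s) = tens (wedge_form w e) s.
Proof.
apply: (tlift_tens (b := fun (e : diff_form M l) s => tens (wedge_form w e) s)).
- by move=> u u' t; rewrite wedgeDr tensDl.
- by move=> u t t'; rewrite tensDr.
- by move=> f u t; rewrite wedgeZr tensZl tensZr.
Qed.

Lemma wedgeTD k l (w : diff_form M k) (x y : tensor (diff_form M l) (smooth_section)) :
  wedgeT w (x + y) = wedgeT w x + wedgeT w y.
Proof.
apply: (tliftD (b := fun (e : diff_form M l) s => tens (wedge_form w e) s)).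
- by move=> u u' t; rewrite wedgeDr tensDl.
- by move=> u t t'; rewrite tensDr.
- by move=> f u t; rewrite wedgeZr tensZl tensZr.
Qed.

(* A real scalar c acts on the Omega^0(M)-module Omega^k(xi) as the constant
   function sfun_cst M c. *)
Definition pseudoconnection (P : bundle_endo) (nabla : Omega 0 -> Omega 1) : Prop :=
  (forall (c : R) s t, nabla (sfun_cst M c *: s + t) = sfun_cst M c *: nabla s + nabla t) /\
  (forall (f : sfun M) (s : smooth_section),
     nabla (f *: s) = tens (extd (form_of_sfun f)) (endo_section P s) + f *: nabla s).

(* For k = 0, where Omega^0(xi) is the module of sections itself, the condition
   is dnabla 0 = nabla; the formula on generators is imposed for k >= 1. *)
Definition exterior_derivative (P : bundle_endo) (nabla : Omega 0 -> Omega 1)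
    (dnabla : forall k, Omega k -> Omega (k + 1)) : Prop :=
  [/\ forall k (c : R) u v, dnabla k (sfun_cst M c *: u + v) =
        sfun_cst M c *: dnabla k u + dnabla k v,
      forall s, dnabla 0%N s = nabla s
    & forall k (w : diff_form M k.+1) (s : smooth_section),
        dnabla k.+1 (tens w s) =
        tens (extd w) (endo_section P s) + (-1) ^+ k.+1 *: wedgeT w (nabla s)].

Definition Fnabla (P : bundle_endo) (nabla : Omega 0 -> Omega 1)
    (dnabla : forall k, Omega k -> Omega (k + 1)) : Omega 0 -> Omega 2 :=
  fun s => endo_act P (dnabla 1 (nabla s)) - dnabla 1 (endo_act P (nabla s))
           + dnabla 1 (nabla (endo_act P s)).

Definition Lnabla (P : bundle_endo) (nabla : Omega 0 -> Omega 1) :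
    Omega 0 -> Omega 1 :=
  fun s => endo_act P (nabla s) - nabla (endo_act P s).

End sections.

(* Main.v *)
(* Write D for dnabla. The Leibniz rule for 1-forms and d(df) = 0 give
   D(f x) = df /\ P x + f D x for x in Omega^1(xi), and
   D(df (x) s) = - df /\ nabla s. Since P commutes with df /\ _, expanding
   F(f s) leaves, besides f F(s), only terms involving df that cancel in pairs:
   P(df /\ P nabla s) against df /\ P P nabla s, P(df /\ nabla P s) against
   df /\ P nabla P s, and D(df (x) P P s) against itself. *)
Require Import Defs.
From mathcomp Require Import all_boot all_order all_algebra.
From mathcomp Require Import all_classical all_reals topology normedtype derive.
From mathcomp Require Import all_fingroup.
Set Implicit Arguments.
Unset Strict Implicit.
Unset Printing Implicit Defensive.
Import GRing.Theory Num.Theory.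
Import numFieldTopology.Exports numFieldNormedType.Exports.
Local Open Scope ring_scope.

Section one_form_wedge.
Variables (R : realType) (V : lmodType R).

(** Group the permutations by the index [a] that they assign to the slot of [e]. Each group is a
    copy of ['S_k], and since [w] alternates, all its [k!] terms are equal, which cancels the
    normalising factor. The resulting sum over [a] has the shape of [dloc]. *)
Lemma wedge_alt_1form k (e : ('I_1 -> V) -> R) (w : ('I_k -> V) -> R)
    (v : 'I_(1 + k) -> V) :
  multilinear_map w -> alternating_map w ->
  wedge_alt e w v =
  \sum_(a < k.+1) (-1) ^+ a * (e (fun=> v a) * w (v \o lift a)).
Proof.
move=> hm ha; rewrite /wedge_alt mul1n.
rewrite (partition_big (fun s : 'S_(1 + k) => s ord0) predT) //= mulr_sumr.
apply: eq_bigr => a _.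
rewrite (reindex (lift_perm ord0 a)); last first.
  (* [ulsf s] is [s] with the source [ord0] and the value [s ord0] deleted and the rest renumbered;
     it inverts [lift_perm ord0 a] on the permutations sending [ord0] to [a]. *)
  pose ulsf (s : 'S_k.+1) (i : 'I_k) : 'I_k := odflt i (unlift (s ord0) (s (lift ord0 i))).
  have ulsfK (s : 'S_k.+1) (i : 'I_k) : lift (s ord0) (ulsf s i) = s (lift ord0 i).
    rewrite /ulsf; have : s ord0 != s (lift ord0 i).
      by rewrite (inj_eq perm_inj) neq_lift.
    by case/unlift_some => j -> ->.
  have inj (s : 'S_k.+1) : injective (ulsf s).
    by move=> i j /(congr1 (lift (s ord0))); rewrite !ulsfK => /perm_inj/lift_inj.
  exists (fun s => perm (inj s)) => [s _ | s].
    by apply/permP => i; apply: (@lift_inj _ a);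
      rewrite permE -{1}(lift_perm_id ord0 a s) ulsfK lift_perm_lift.
  rewrite inE => /eqP sa; apply/permP => i; case: (unliftP ord0 i) => [j ->|->].
    by rewrite lift_perm_lift permE -sa ulsfK.
  by rewrite lift_perm_id.
transitivity (k`!%:R^-1 * \sum_(s : 'S_k)
    (-1) ^+ a * (e (fun=> v a) * w (v \o lift a)) : R).
  congr (_ * _); apply: eq_big => [s|s _]; first by rewrite lift_perm_id eqxx.
  have -> : v \o (lift_perm ord0 a s : 'S_(1 + k)) \o lshift k = fun=> v a.
    apply/funext => i /=; congr v.
    have -> : lshift k i = ord0 by apply/val_inj; rewrite /= ord1.
    by rewrite lift_perm_id.
  have -> : v \o (lift_perm ord0 a s : 'S_(1 + k)) \o @rshift 1 k = (v \o lift a) \o s.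
    apply/funext => i /=; congr v.
    have -> : rshift 1 i = lift ord0 i by apply/val_inj.
    by rewrite lift_perm_lift.
  (* The lifted permutation has sign [(-1) ^+ a] times that of [s]; [alt_perm] yields the sign of
     [s] again, and the two copies square to 1. *)
  rewrite alt_perm // odd_lift_perm /= signr_addb signr_odd.
  rewrite [e _ * (_ * _)]mulrCA !mulrA; congr (_ * _ * _).
  by rewrite -mulrA -expr2 sqrr_sign mulr1.
rewrite sumr_const card_Sn -[X in _ * X]mulr_natl mulKf //.
by rewrite pnatr_eq0 -lt0n fact_gt0.
Qed.

End one_form_wedge.

Section forms.
Variables (R : realType) (n : nat) (M : manifold R n).
Implicit Types f : sfun M.

Lemma sfun_smooth f i : smooth_on (cim i) (f \o @param _ _ M i).
Proof. by apply: smooth_sub (sfunP f i) => y iy; split. Qed.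

Lemma extdE k (w : diff_form M k) i y v : cim i y ->
  extd w i y v = dloc (w i) y (v \o cast_ord (esym (addn1 k))).
Proof. by move=> iy /=; rewrite asboolT. Qed.

Lemma extd_sfunE f i y (v : 'I_1 -> 'rV[R]_n) : cim i y ->
  extd (form_of_sfun f) i y v = 'D_(v ord0) (f \o param i) y.
Proof.
move=> iy; rewrite extdE // /dloc big_ord1 expr0 mul1r /=.
have -> : cast_ord (esym (addn1 0)) ord0 = ord0 by apply/val_inj.
(* [form_of_sfun] is cut off to 0 outside [cim i]; as [cim i] is open, the cut-off is invisible near
   [y]. *)
apply: near_eq_derive; near=> z.
have iz : cim i z by near: z; apply: open_nbhs_nbhs; split=> //; exact: im_open.
by rewrite asboolT.
Unshelve. all: by end_near. Qed.

(** In a chart only two second derivatives of [f] remain, with opposite signs and the order of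
    differentiation exchanged, so [schwarz] makes them cancel. *)
Lemma extd_extd_sfun f : extd (extd (form_of_sfun f)) = 0.
Proof.
apply: form_ext => i y v iy; rewrite extdE // /dloc.
have E (u : 'I_1 -> 'rV[R]_n) x :
    'D_x (fun z => extd (form_of_sfun f) i z u) y =
    'D_x ('D_(u ord0) (f \o param i)) y.
  apply: near_eq_derive; near=> z; apply: extd_sfunE.
  by near: z; apply: open_nbhs_nbhs; split=> //; exact: im_open.
rewrite (eq_bigr _ (fun a _ => congr1 _ (E _ _))) big_ord_recl big_ord1.
rewrite expr0 mul1r expr1 mulN1r /=.
rewrite (schwarz _ _ (@im_open _ _ M i) (sfun_smooth f i 2%N) iy) /=.
apply/eqP; rewrite subr_eq0; apply/eqP.
by have -> : lift (lift ord0 ord0) ord0 = ord0 :> 'I_(0 + 1).+1 by apply/val_inj.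
Unshelve. all: by end_near. Qed.

(** Apply the product rule in each term of [dloc]: the derivatives of [f] assemble into [df /\ w] as
    expanded by [wedge_alt_1form], those of [w] into [f dw]. *)
Lemma extdZ f (w : diff_form M 1) :
  extd (f *: w) = wedge_form (extd (form_of_sfun f)) w + f *: extd w.
Proof.
apply: form_ext => i y v iy.
rewrite extdE // -[RHS]/(wedge_alt (extd (form_of_sfun f) i y) (w i y) v
  + f (param i y) * extd w i y v).
rewrite extdE // wedge_alt_1form; last 2 first.
- exact: form_multilinear.
- exact: form_alternating.
have -> : v \o cast_ord (esym (addn1 1)) = v.
  by apply/funext => a /=; congr v; apply/val_inj.
rewrite /dloc mulr_sumr -big_split; apply: eq_bigr => a _ /=.
rewrite [f _ * _]mulrCA -mulrDr; congr (_ * _).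
have df : differentiable (f \o param i) y.
  exact: smooth_differentiable (sfun_smooth f i) iy.
have dw : differentiable ((w i)^~ (v \o lift a)) y.
  exact: form_differentiable.
rewrite -[LHS]/('D_(v a) ((f \o param i) * (w i)^~ (v \o lift a)) y).
rewrite deriveM; [|exact: diff_derivable|exact: diff_derivable].
by rewrite -(extd_sfunE f (fun=> v a) iy) addrC [_ *: _]mulrC.
Qed.

End forms.

Section bundle_valued_forms.
Variables (R : realType) (n : nat) (M : manifold R n) (xi : vector_bundle M).
Implicit Types (P : bundle_endo xi) (f : sfun M).

(** In positive degree [tlift] provides additivity only; induction on sums of pure tensors gives the
    rest, with [f] absorbed into the form factor. *)
Lemma endo_actZ P k f (x : Omega xi k) :
  endo_act P (f *: x) = f *: endo_act P x.
Proof.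
case: k x => [|k] x; first exact: endo_sectionZ.
elim/tensor_ind: x => [|w s x IH].
  rewrite scaler0; suff -> : endo_act P (0 : Omega xi k.+1) = 0 by rewrite scaler0.
  by apply: (addrI (endo_act P (0 : Omega xi k.+1))); rewrite -actD !addr0.
rewrite scalerDr -tensZl.
rewrite (actD P (tens (f *: w) s : Omega xi k.+1)) IH.
by rewrite (actD P (tens w s : Omega xi k.+1)) !act_tens tensZl scalerDr.
Qed.

Lemma endo_act0 P k : endo_act P (0 : Omega xi k) = 0.
Proof. by rewrite -(scale0r (0 : Omega xi k)) endo_actZ !scale0r. Qed.

Lemma endo_actN P k (x : Omega xi k) : endo_act P (- x) = - endo_act P x.
Proof. by rewrite -scaleN1r endo_actZ scaleN1r. Qed.

Lemma wedgeT0 k l (w : diff_form M k) :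
  wedgeT w (0 : tensor (diff_form M l) (smooth_section xi)) = 0.
Proof. by apply: (addrI (wedgeT w 0)); rewrite -wedgeTD !addr0. Qed.

Lemma wedgeTZl k l f (w : diff_form M k)
    (x : tensor (diff_form M l) (smooth_section xi)) :
  wedgeT (f *: w) x = f *: wedgeT w x.
Proof.
elim/tensor_ind: x => [|e s x IH]; first by rewrite !wedgeT0 scaler0.
by rewrite !wedgeTD IH !wedgeT_tens wedgeZl tensZl scalerDr.
Qed.

(** On a pure tensor [P] changes only the section and [w] only the form. The degrees are written as
    successors so that [Omega] reduces to the tensor product. *)
Lemma endo_act_wedgeT P k l (w : diff_form M k.+1) (x : Omega xi l.+1) :
  endo_act P (wedgeT w x : Omega xi (k.+1 + l.+1)) = wedgeT w (endo_act P x).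
Proof.
elim/tensor_ind: x => [|e s x IH]; first by rewrite wedgeT0 !endo_act0 wedgeT0.
rewrite wedgeTD (actD P (wedgeT w (tens e s) : Omega xi (k.+1 + l.+1))) IH.
rewrite (actD P (tens e s : Omega xi l.+1)) wedgeTD; congr (_ + _).
by rewrite wedgeT_tens !act_tens wedgeT_tens.
Qed.

End bundle_valued_forms.

Section pseudoconnection.
Variables (R : realType) (n : nat) (M : manifold R n) (xi : vector_bundle M).
Variables (P : bundle_endo xi) (nabla : Omega xi 0 -> Omega xi 1).
Variable dnabla : forall k : nat, Omega xi k -> Omega xi (k + 1).
Hypothesis pseudo_nabla : pseudoconnection P nabla.
Hypothesis ext_dnabla : exterior_derivative P nabla dnabla.
Implicit Types (f : sfun M) (s t : smooth_section xi).
Let df f : diff_form M 1 := extd (form_of_sfun f).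

Lemma nablaD s t : nabla (s + t) = nabla s + nabla t.
Proof. by have [/(_ 1 s t) + _] := pseudo_nabla; rewrite !scale1r. Qed.

Lemma dnablaD k (x y : Omega xi k) : dnabla (x + y) = dnabla x + dnabla y.
Proof. by have [/(_ k 1 x y) + _ _] := ext_dnabla; rewrite !scale1r. Qed.

Lemma dnabla0 k : dnabla (0 : Omega xi k) = 0.
Proof. by apply: (addrI (dnabla (0 : Omega xi k))); rewrite -dnablaD !addr0. Qed.

Lemma dnabla_tens (w : diff_form M 1) s :
  dnabla (tens w s : Omega xi 1) =
  (tens (extd w) (endo_section P s) : Omega xi 2) - wedgeT w (nabla s).
Proof. by have [_ _ ->] := ext_dnabla; rewrite expr1 scaleN1r. Qed.

Lemma dnabla_df f s :
  dnabla (tens (df f) s : Omega xi 1) = - wedgeT (df f) (nabla s).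
Proof.
(* Writing the zero 2-form as [0 *: 0] lets [tensZl] turn the tensor it heads into zero. *)
by rewrite dnabla_tens extd_extd_sfun -(scale0r (0 : diff_form M 2)) tensZl
  scale0r add0r.
Qed.

(** On [w (x) s], the extra part of [d(f w)] gives [(df /\ w) (x) P s], which is [df /\ P(w (x) s)]:
    the [P] in the generator formula is what twists the Leibniz rule. *)
Lemma dnablaZ f (x : Omega xi 1) :
  dnabla (f *: x) = (wedgeT (df f) (endo_act P x) : Omega xi 2) + f *: dnabla x.
Proof.
elim/tensor_ind: x => [|w s x IH].
  by rewrite scaler0 dnabla0 endo_act0 wedgeT0 scaler0 addr0.
rewrite scalerDr -tensZl (dnablaD (tens (f *: w) s : Omega xi 1)) IH.
rewrite (dnablaD (tens w s : Omega xi 1)) (actD P (tens w s : Omega xi 1)).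
rewrite wedgeTD scalerDr addrACA; congr (_ + _).
rewrite !dnabla_tens act_tens wedgeT_tens extdZ tensDl tensZl wedgeTZl.
by rewrite scalerBr addrA.
Qed.

Lemma LnablaD s t : Lnabla P nabla (s + t) = Lnabla P nabla s + Lnabla P nabla t.
Proof. by rewrite /Lnabla (@actD _ _ _ _ P 0 s t) !nablaD actD opprD addrACA. Qed.

(** Both compositions produce the same non-tensorial term [df (x) P P s], which their difference
    removes. *)
Lemma LnablaZ f s : Lnabla P nabla (f *: s) = f *: Lnabla P nabla s.
Proof.
have [_ nablaZ] := pseudo_nabla.
rewrite /Lnabla (@endo_actZ _ _ _ _ P 0 f s) !nablaZ actD act_tens endo_actZ.
by rewrite opprD addrACA subrr add0r -scalerBr.
Qed.

Lemma FnablaD s t :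
  Fnabla P nabla dnabla (s + t) = Fnabla P nabla dnabla s + Fnabla P nabla dnabla t.
Proof.
rewrite /Fnabla (@actD _ _ _ _ P 0 s t) !nablaD (actD P (nabla s)) !dnablaD.
rewrite (actD P (dnabla (nabla s))) opprD [RHS]addrACA; congr (_ + _).
exact: addrACA.
Qed.

Lemma FnablaZ f s : Fnabla P nabla dnabla (f *: s) = f *: Fnabla P nabla dnabla s.
Proof.
have [_ nablaZ] := pseudo_nabla.
rewrite /Fnabla (@endo_actZ _ _ _ _ P 0 f s) !nablaZ.
rewrite (actD P (tens _ _ : Omega xi 1)) act_tens endo_actZ !dnablaD !dnabla_df !dnablaZ.
rewrite (actD P (- wedgeT (df f) _ : Omega xi 2)) endo_actN.
rewrite (actD P (wedgeT (df f) _ : Omega xi 2)) !(@endo_act_wedgeT _ _ _ _ P 0 0).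
rewrite endo_actZ scalerDr scalerBr.
(* Here [a], [b], [c] stand for [df] wedged with [P nabla P s], [P P nabla s] and [nabla P P s];
   [x], [y], [z] are [f] times the three terms of [Fnabla] at [s]. *)
have cancel (V : zmodType) (a b c x y z : V) :
    - a + (b + x) - (- c + (b + y)) + (- c + (a + z)) = x - y + z.
  have -> : - a + (b + x) - (- c + (b + y)) = - a + c + (x - y).
    by rewrite opprD opprK addrACA; congr (_ + _); rewrite opprD addrACA subrr add0r.
  have -> : - c + (a + z) = - (- a + c) + z.
    by rewrite opprD opprK addrA [a - c]addrC.
  by rewrite addrACA subrr add0r.
exact: cancel.
Qed.

End pseudoconnection.

Theorem theorem2p3 (R : realType) (n : nat) (M : manifold R n)
    (xi : vector_bundle M) (P : bundle_endo xi)
    (nabla : Omega xi 0 -> Omega xi 1)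
    (dnabla : forall k : nat, Omega xi k -> Omega xi (k + 1)) :
  pseudoconnection P nabla ->
  exterior_derivative P nabla dnabla ->
  linear (Fnabla P nabla dnabla : Omega xi 0 -> Omega xi 2) /\
  linear (Lnabla P nabla : Omega xi 0 -> Omega xi 1).
Proof.
move=> hP hd; split=> f s t.
  by rewrite (FnablaD hP hd) (FnablaZ hP hd).
by rewrite (LnablaD hP) (LnablaZ hP).
Qed.
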